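(* Let $(M,\varphi,\xi,\eta,g)$ be a contact pseudo-metric manifold and let $h=\frac12\pounds_\xi\varphi$. Then the following statements are true: (a) If $h$ is a Codazzi tensor, i.e. $(\nabla_X h)Y=(\nabla_Y h)X$ for all $X,Y\in TM$, then $h^2=0$. (b) $M$ is a Sasakian pseudo-metric manifold if and only if both $R(X,Y)\xi=\eta(Y)X-\eta(X)Y$ holds for all $X,Y\in TM$ and $h$ is a Codazzi tensor.
   Context: An almost contact pseudo-metric manifold $(M,\varphi,\xi,\eta,g)$ is a smooth connected manifold $M$ of dimension $2n+1$ with a $(1,1)$ tensor field $\varphi$, a vector field $\xi$, a $1$-form $\eta$ and a pseudo-Riemannian metric $g$ such that $\varphi^2=-I+\eta\otimes\xi$, $\eta(\xi)=1$, $\varphi\xi=0$, $\eta\circ\varphi=0$, and $g(\varphi X,\varphi Y)=g(X,Y)-\varepsilon\eta(X)\eta(Y)$ for all $X,Y$, where $\varepsilon=\pm1$ is a fixed sign; this condition is equivalent to $\eta(X)=\varepsilon g(X,\xi)$ together with $g(\varphi X,Y)=-g(X,\varphi Y)$, and so $g(\xi,\xi)=\varepsilon$. It is a contact pseudo-metric manifold if $d\eta=\Phi$, where $\Phi(X,Y)=g(X,\varphi Y)$ and $d\eta(X,Y)=\frac12\big(X\eta(Y)-Y\eta(X)-\eta([X,Y])\big)$. $\nabla$ is the Levi-Civita connection of $g$, $R(X,Y)=[\nabla_X,\nabla_Y]-\nabla_{[X,Y]}$, $\pounds$ is the Lie derivative, and $(\nabla_XA)Y=\nabla_X(AY)-A(\nabla_XY)$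 for a $(1,1)$ tensor $A$. On a contact pseudo-metric manifold $h=\frac12\pounds_\xi\varphi$ is self-adjoint with respect to $g$. A contact pseudo-metric manifold is a Sasakian pseudo-metric manifold if the almost complex structure $J\left(X,f\frac{d}{dt}\right)=\left(\varphi X-f\xi,\eta(X)\frac{d}{dt}\right)$ on $M\times\mathbb{R}$ is integrable, where $X\in TM$, $t$ is the coordinate on $\mathbb{R}$ and $f$ is a $C^\infty$ function on $M\times\mathbb{R}$; it is well known that this is equivalent to $(\nabla_X\varphi)Y=g(X,Y)\xi-\varepsilon\eta(Y)X$ for all $X,Y$. *)

(* Defs.v *)
From mathcomp Require Import all_boot all_order all_algebra.
From mathcomp Require Import all_classical all_reals all_analysis.

Set Implicit Arguments.
Unset Strict Implicit.
Unset Printing Implicit Defensive.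

Import Order.TTheory GRing.Theory Num.Theory.
Import numFieldNormedType.Exports.

Local Open Scope classical_set_scope.
Local Open Scope ring_scope.

(* C^oo on an open set U: every iterated directional derivative of f is
   (Frechet) differentiable, hence continuous, at every point of U. *)
Definition smooth_on {R : realType} {V W : normedModType R}
    (U : set V) (f : V -> W) : Prop :=
  forall (vs : seq V) (x : V), U x ->
    differentiable (foldr (fun v (g : V -> W) => 'D_v g) f vs) x.

(* The values of chart_map outside chart_dom, and of chart_inv outside
   chart_img, are irrelevant. *)
Record chart (R : realType) (M : topologicalType) (E : normedModType R) := Chart {
  chart_dom : set M;
  chart_map : M -> E;
  chart_inv : E -> M }.

Section Manifold.
Context {R : realType} {M : topologicalType} {E : normedModType R}.

Definition chart_img (c : chart M E) : set E := chart_map c @` chart_dom c.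

Definition is_chart (c : chart M E) : Prop :=
  [/\ open (chart_dom c), open (chart_img c),
      forall p, chart_dom c p -> chart_inv c (chart_map c p) = p,
      {within chart_dom c, continuous (chart_map c)} &
      {within chart_img c, continuous (chart_inv c)}].

(* An atlas is given as a family of charts A indexed by the points of M, A p
   being a chart around p.  The chart A p is used to identify the tangent space
   T_p M with the model space E, so a vector field is a map M -> E, a (1,1)
   tensor field a family of linear maps E -> E, and so on; components with
   respect to another chart are obtained through the derivative of the change
   of charts (see [read] below). *)
Variable A : M -> chart M E.

Definition smooth_manifold : Prop :=
  [/\ hausdorff_space M, @second_countable M, connected [set: M],
      forall p, is_chart (A p) /\ chart_dom (A p) p &
      forall p q, smooth_on
        (chart_map (A p) @` (chart_dom (A p) `&` chart_dom (A q)))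
        (chart_map (A q) \o chart_inv (A p))].

Definition smooth_fun (f : M -> R^o) : Prop :=
  forall p, smooth_on (chart_img (A p)) (f \o chart_inv (A p)).

(* X f *)
Definition act (X : M -> E) (f : M -> R^o) : M -> R^o := fun p =>
  'D_(X p) (f \o chart_inv (A p)) (chart_map (A p) p).

(* The coordinate expression of X in the chart A p. *)
Definition read (p : M) (X : M -> E) : E -> E := fun y =>
  let q := chart_inv (A p) y in
  'D_(X q) (chart_map (A p) \o chart_inv (A q)) (chart_map (A q) q).

Definition smooth_vf (X : M -> E) : Prop :=
  forall p, smooth_on (chart_img (A p)) (read p X).

(* [X, Y] = DY.X - DX.Y at p, in the chart A p, in which the components of
   X and Y at p are X p and Y p. *)
Definition bracket (X Y : M -> E) : M -> E := fun p =>
  'D_(X p) (read p Y) (chart_map (A p) p)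
  - 'D_(Y p) (read p X) (chart_map (A p) p).

(* The operator on vector fields induced by a (1,1) tensor field. *)
Definition on_vf (T : M -> E -> E) (X : M -> E) : M -> E := fun p => T p (X p).

Definition tensor11 (T : M -> E -> E) : Prop :=
  (forall p, linear (T p)) /\
  (forall X, smooth_vf X -> smooth_vf (on_vf T X)).

Definition one_form (eta : M -> E -> R^o) : Prop :=
  (forall p, linear (eta p)) /\
  (forall X, smooth_vf X -> smooth_fun (fun p => eta p (X p))).

Definition pseudo_metric (g : M -> E -> E -> R^o) : Prop :=
  [/\ forall p u v, g p u v = g p v u,
      forall p u, linear (g p u),
      forall p u, (forall v, g p u v = 0) -> u = 0 &
      forall X Y, smooth_vf X -> smooth_vf Y ->
        smooth_fun (fun p => g p (X p) (Y p))].

(* nabla X Y is only meaningful for smooth X and Y. *)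
Definition levi_civita (g : M -> E -> E -> R^o)
    (nabla : (M -> E) -> (M -> E) -> (M -> E)) : Prop :=
  [/\ forall X Y, smooth_vf X -> smooth_vf Y -> smooth_vf (nabla X Y),
      (forall X X' Y f, smooth_vf X -> smooth_vf X' -> smooth_vf Y ->
         smooth_fun f ->
         nabla (fun p => f p *: X p + X' p) Y
         = (fun p => f p *: nabla X Y p + nabla X' Y p)),
      (forall X Y Y' f, smooth_vf X -> smooth_vf Y -> smooth_vf Y' ->
         smooth_fun f ->
         nabla X (fun p => f p *: Y p + Y' p)
         = (fun p => act X f p *: Y p + f p *: nabla X Y p + nabla X Y' p)),
      (forall X Y, smooth_vf X -> smooth_vf Y ->
         nabla X Y - nabla Y X = bracket X Y) &
      (forall X Y Z, smooth_vf X -> smooth_vf Y -> smooth_vf Z ->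
         act X (fun p => g p (Y p) (Z p))
         = (fun p => g p (nabla X Y p) (Z p) + g p (Y p) (nabla X Z p)))].

Definition curvature (nabla : (M -> E) -> (M -> E) -> (M -> E))
    (X Y Z : M -> E) : M -> E :=
  nabla X (nabla Y Z) - nabla Y (nabla X Z) - nabla (bracket X Y) Z.

(* In the following, (1,1) tensor fields are given by their action on vector
   fields. *)

Definition lie11 (X : M -> E) (T : (M -> E) -> (M -> E)) (Y : M -> E) : M -> E :=
  bracket X (T Y) - T (bracket X Y).

Definition cov11 (nabla : (M -> E) -> (M -> E) -> (M -> E))
    (X : M -> E) (T : (M -> E) -> (M -> E)) (Y : M -> E) : M -> E :=
  nabla X (T Y) - T (nabla X Y).

Definition codazzi (nabla : (M -> E) -> (M -> E) -> (M -> E))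
    (T : (M -> E) -> (M -> E)) : Prop :=
  forall X Y, smooth_vf X -> smooth_vf Y -> cov11 nabla X T Y = cov11 nabla Y T X.

Definition nijenhuis (T : (M -> E) -> (M -> E)) (X Y : M -> E) : M -> E :=
  T (T (bracket X Y)) + bracket (T X) (T Y)
  - T (bracket (T X) Y) - T (bracket X (T Y)).

(* For an almost complex structure, integrability is the vanishing of the
   Nijenhuis torsion. *)
Definition integrable (J : (M -> E) -> (M -> E)) : Prop :=
  forall X Y, smooth_vf X -> smooth_vf Y -> nijenhuis J X Y = (fun=> 0).

Definition d1 (eta : M -> E -> R^o) (X Y : M -> E) : M -> R^o := fun p =>
  2^-1 * (act X (fun q => eta q (Y q)) p - act Y (fun q => eta q (X q)) p
          - eta p (bracket X Y p)).

End Manifold.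

Definition prod_chart {R : realType} {M : topologicalType} {E : normedModType R}
    (c : chart M E) : chart (M * R^o)%type (E * R^o)%type :=
  {| chart_dom := [set x | chart_dom c x.1];
     chart_map := fun x => (chart_map c x.1, x.2);
     chart_inv := fun y => (chart_inv c y.1, y.2) |}.

(* The manifold M x R; the tangent space at (p, t) is E * R, where (u, a)
   stands for (u, a d/dt). *)
Definition prod_atlas {R : realType} {M : topologicalType} {E : normedModType R}
    (A : M -> chart M E) (x : M * R^o) : chart (M * R^o)%type (E * R^o)%type :=
  prod_chart (A x.1).

Section ContactPseudoMetric.
Context {R : realType} {n : nat} {M : topologicalType}.
Let E : normedModType R := 'rV[R]_(n.*2.+1).
Variables (A : M -> chart M E) (phi : M -> E -> E) (xi : M -> E)
  (eta : M -> E -> R^o) (g : M -> E -> E -> R^o) (eps : R).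

(* The index of g is not required to be constant: this is automatic, M being
   connected. *)
Record almost_contact_pseudo_metric : Prop := AlmostContactPseudoMetric {
  acpm_manifold : smooth_manifold A;
  acpm_phi : tensor11 A phi;
  acpm_xi : smooth_vf A xi;
  acpm_eta : one_form A eta;
  acpm_g : pseudo_metric A g;
  acpm_eps : eps = 1 \/ eps = -1;
  acpm_phi2 : forall p u, phi p (phi p u) = - u + eta p u *: xi p;
  acpm_eta_xi : forall p, eta p (xi p) = 1;
  acpm_phi_xi : forall p, phi p (xi p) = 0;
  acpm_eta_phi : forall p u, eta p (phi p u) = 0;
  acpm_compat : forall p u v,
    g p (phi p u) (phi p v) = g p u v - eps * eta p u * eta p v }.

Definition contact_pseudo_metric : Prop :=
  almost_contact_pseudo_metric /\
  forall X Y, smooth_vf A X -> smooth_vf A Y ->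
    d1 A eta X Y = (fun p => g p (X p) (phi p (Y p))).

Definition h_tensor (X : M -> E) : M -> E := fun p =>
  2^-1 *: lie11 A xi (on_vf phi) X p.

Definition J_tensor (x : M * R^o) (z : E * R^o) : E * R^o :=
  (phi x.1 z.1 - z.2 *: xi x.1, eta x.1 z.1).

Definition sasakian_pseudo_metric : Prop :=
  contact_pseudo_metric /\ integrable (prod_atlas A) (on_vf J_tensor).

End ContactPseudoMetric.

(* Main.v *)
Require Import Defs.
From HB Require Import structures.
From mathcomp Require Import all_boot all_order all_algebra.
From mathcomp Require Import all_classical all_reals all_analysis.
From mathcomp Require Import ring lra.

Import Order.TTheory GRing.Theory Num.Theory.
Import numFieldNormedType.Exports.

Local Open Scope classical_set_scope.
Local Open Scope ring_scope.

Set Implicit Arguments.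
Unset Strict Implicit.
Unset Printing Implicit Defensive.

(** Let B X be the covariant derivative of xi along X. By the contact condition the
    skew part of B is - eps phi; let S be its self-adjoint part, so B = S - eps phi.
    The 2-form g(X, phi Y) is closed, since it is d eta; written with the connection
    this is a cyclic identity (T_cyclic) for the covariant derivative T of phi. It
    implies that S anticommutes with phi, that phi is parallel along xi, and that
    h = phi S (S_phi, T_of_xi0, h_eq).

    If h is a Codazzi tensor, the Codazzi equation for X and xi computes the
    covariant derivative of h along xi as eps S - phi S^2. The left-hand side and S
    are self-adjoint and phi S^2 is skew, so phi S^2 = 0, whence h^2 = S^2 = 0
    (codazzi_xi). As g is indefinite, h need not vanish. But the curvature condition
    for X and xi then forces the covariant derivative of S along xi to vanish, so
    S = 0 (K_contact). Once S = 0, R(X, Y) xi is a multiple of T X Y - T Y X, and the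
    cyclic identity recovers T from this difference: the result is the Sasakian
    equation T X Y = g(X, Y) xi - eps eta(Y) X (curv_sasakian). Conversely, the
    Sasakian equation and S = 0 give the curvature condition and h = 0.

    The Sasakian structure is defined by the integrability of J on M x R. The product
    of the connection with d/dt is torsion-free, so the Nijenhuis torsion of J is
    the antisymmetrisation of (D_(J Z) J) W - J (D_Z J) W (nij1E, nij2E), which
    vanishes under the Sasakian equation. If the torsion vanishes on the fields without
    d/dt component, its value on X and xi gives S = 0, and its cyclic sums give the
    Sasakian equation (normal_S0, normal_sasakian).

    Tensors and connections act here on global vector fields only, and an identity
    between them is pointwise only if there are enough such fields. They are produced
    by cutoff functions, from bump functions and the Hausdorff property
    (exists_cutoff, exists_smooth_vf, vf_eq0). The rule [X, Y] f = X (Y f) - Y (X f)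
    comes from the symmetry of second derivatives (derive_comm, act_bracket), and the
    Jacobi identity follows by testing on functions. Finally, a field on M x R is
    a family of fields on M depending on t, and the derivatives in t cancel in the
    Nijenhuis torsion of J (nijenhuis_prod). *)

(** * Directional derivatives and smooth maps *)

Section Calculus.
Context {R : realType}.
Implicit Types V W X : normedModType R.

(** Differentiability is local: the two maps have the same first-order expansion. *)
Lemma near_eq_differentiable V W (f g : V -> W) x :
  (\near x, f x = g x) -> differentiable f x -> differentiable g x.
Proof.
move=> fg df.
have dg : g \o shift x = cst (g x) + 'd f x +o_ 0 id.
  apply/eqaddoP => _/posnumP[e].
  have := diff_locally df => /eqaddoP/(_ _ (gt0 e)) He.
  near=> h.
  have -> : (g \o shift x - (cst (g x) + 'd f x)) h
          = (f \o shift x - (cst (f x) + 'd f x)) h.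
    rewrite !fctE /= (nbhs_singleton fg); congr (_ - _).
    near: h; move: fg; rewrite (near_shift 0 x) /= subr0.
    by apply: filterS => h /=  ->.
  by near: h.
apply/diff_locallyP; rewrite (diff_unique (diff_continuous df) dg).
by split=> //; exact: diff_continuous.
Unshelve. all: by end_near. Qed.

Lemma nbhs_near_eq (T : topologicalType) (S : Type) (f g : T -> S) (x : T) :
  (\forall z \near x, f z = g z) ->
  \forall y \near x, \forall z \near y, f z = g z.
Proof. exact: near_join. Qed.

Lemma derive_linear V W (f : V -> W) x (a : R) u v : differentiable f x ->
  'D_(a *: u + v) f x = a *: 'D_u f x + 'D_v f x.
Proof. by move=> df; rewrite !deriveE // linearP. Qed.

Lemma derive_comp V W X (f : V -> W) (g : W -> X) x v :
  differentiable f x -> differentiable g (f x) ->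
  'D_v (g \o f) x = 'D_('D_v f x) g (f x).
Proof.
move=> df dg.
by rewrite (deriveE _ (differentiable_comp df dg)) diff_comp // (deriveE _ df)
  (deriveE _ dg).
Qed.

Lemma scale_is_bilinear W : bilinear_for
    (GRing.Scale.Law.clone _ _ *:%R _) (GRing.Scale.Law.clone _ _ *:%R _)
    (@GRing.scale R W : R^o -> W -> W).
Proof.
split=> [u'|u] a x y /=; first by rewrite scalerDl scalerA.
by rewrite scalerDr !scalerA mulrC.
Qed.

(** The product rule, scaling being a continuous bilinear map. *)
Lemma is_diff_scale V W (f df : V -> R^o) (g dg : V -> W) x :
  is_diff x f df -> is_diff x g dg ->
  is_diff x (fun y => f y *: g y) (fun v => f x *: dg v + df v *: g x).
Proof.
move=> df' dg'.
pose bM := bilinear_isBilinear.Build _ _ _ _ _ _ _ (scale_is_bilinear W).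
pose b : {bilinear R^o -> W -> W} := HB.pack (@GRing.scale R W : R^o -> W -> W) bM.
have cb : continuous (fun p : R^o * W => b p.1 p.2) by exact: scale_continuous.
have db : is_diff (f x, g x) (fun p : R^o * W => b p.1 p.2)
    (fun q => f x *: q.2 + q.1 *: g x).
  by apply: DiffDef; [exact: differentiable_bilin | rewrite diff_bilin].
exact: (is_diff_comp (is_diff_pair df' dg') db).
Qed.

Lemma differentiable_scale V W (f : V -> R^o) (g : V -> W) x :
  differentiable f x -> differentiable g x ->
  differentiable (fun y => f y *: g y) x.
Proof.
move=> /differentiableP df /differentiableP dg.
by have := is_diff_scale df dg => -[].
Qed.

Lemma derive_scale V W (f : V -> R^o) (g : V -> W) x v :
  differentiable f x -> differentiable g x ->
  'D_v (fun y => f y *: g y) x = 'D_v f x *: g x + f x *: 'D_v g x.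
Proof.
move=> df dg; rewrite deriveE; last exact: differentiable_scale.
have := is_diff_scale (differentiableP df) (differentiableP dg) => -[_ ->].
by rewrite addrC !deriveE.
Qed.

Lemma derive_add V W (f g : V -> W) x v :
  differentiable f x -> differentiable g x ->
  'D_v (fun y => f y + g y) x = 'D_v f x + 'D_v g x.
Proof. by move=> df dg; rewrite -deriveD //; exact: diff_derivable. Qed.

Lemma derive_pair V W X (f : V -> W) (g : V -> X) x v :
  differentiable f x -> differentiable g x ->
  'D_v (fun y => (f y, g y)) x = ('D_v f x, 'D_v g x).
Proof.
by move=> df dg; rewrite !deriveE ?diff_pair//; exact: differentiable_pair.
Qed.

Lemma derive_clin V W X (l : W -> X) (f : V -> W) x v :
  linear l -> continuous l -> differentiable f x ->
  differentiable (l \o f) x /\ 'D_v (l \o f) x = l ('D_v f x).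
Proof.
move=> ll lc df.
pose lM := GRing.isLinear.Build _ _ _ _ _ ll.
pose lL : {linear _ -> _} := HB.pack l lM.
have dl y : differentiable l y by exact: (@linear_differentiable _ _ _ lL).
split; first exact: differentiable_comp.
rewrite derive_comp // deriveE //.
by rewrite (@diff_lin _ _ _ lL).
Qed.

Section SmoothOn.
Context {V W : normedModType R}.
Implicit Types (U : set V) (f g : V -> W).

(** Iterated derivatives are local, since nearby points see the same germ. *)
Lemma near_eq_iterD f g vs (x : V) : (\forall y \near x, f y = g y) ->
  \forall y \near x, foldr (fun v (k : V -> W) => 'D_v k) f vs y
         = foldr (fun v (k : V -> W) => 'D_v k) g vs y.
Proof.
elim: vs => [//|v vs IH] fg /=.
apply: filterS (nbhs_near_eq (IH fg)) => y Hy.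
exact: near_eq_derive.
Qed.

Lemma smooth_on_near U f :
  (forall x, U x -> exists O g, [/\ O x, smooth_on O g & \near x, g x = f x]) ->
  smooth_on U f.
Proof.
move=> H vs x /H [A [g [Ax sg gf]]].
exact: near_eq_differentiable (near_eq_iterD vs gf) (sg vs x Ax).
Qed.

Lemma smooth_on_eq U f g : open U -> (forall x, U x -> g x = f x) ->
  smooth_on U g -> smooth_on U f.
Proof.
move=> oU fg sg; apply: smooth_on_near => x Ux; exists U, g; split=> //.
by apply: filterS (open_nbhs_nbhs (conj oU Ux)); exact: fg.
Qed.

Lemma smooth_on_sub U U' f : U `<=` U' -> smooth_on U' f -> smooth_on U f.
Proof. by move=> UU' sf vs x /UU'; exact: sf. Qed.

Lemma smooth_on_diff U f x : smooth_on U f -> U x -> differentiable f x.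
Proof. by move=> sf Ux; exact: (sf [::]). Qed.

Lemma smooth_on_derive U f v : smooth_on U f -> smooth_on U ('D_v f).
Proof. by move=> sf vs x Ux; have := sf (rcons vs v) x Ux; rewrite foldr_rcons. Qed.

(** A coinduction principle: a class of differentiable maps that is stable, up to
    equality on U, under all directional derivatives consists of smooth maps. Each
    closure property of smoothness below is an instance for a suitable class. *)
Lemma smooth_on_coind U (P : (V -> W) -> Prop) : open U ->
  (forall f, P f -> (forall x, U x -> differentiable f x) /\
     forall v, exists2 g, P g & forall x, U x -> 'D_v f x = g x) ->
  forall f, P f -> smooth_on U f.
Proof.
move=> oU HP f Pf vs; elim/last_ind: vs f Pf => [|vs v IH] f Pf x Ux /=.
  exact: (HP f Pf).1.
rewrite foldr_rcons; have [g Pg gE] := (HP f Pf).2 v.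
apply: near_eq_differentiable (IH g Pg x Ux); apply: near_eq_iterD.
by apply: filterS (open_nbhs_nbhs (conj oU Ux)) => y /gE.
Qed.

End SmoothOn.

Lemma smooth_on_cst V W (U : set V) (c : W) : open U -> smooth_on U (fun=> c).
Proof.
move=> oU; apply: (@smooth_on_coind _ _ _ (fun f => exists c, f = cst c)) => //.
  move=> _ [{}c ->]; split=> [x _|v]; first exact: differentiable_cst.
  by exists (cst 0); [exists 0 | move=> x _; rewrite derive_cst].
by exists c.
Qed.

Lemma smooth_on_id V (U : set V) : open U -> smooth_on U (@id V).
Proof.
move=> oU; apply: (@smooth_on_coind _ _ _
  (fun f => f = id \/ exists c, f = cst c)) => //; last by left.
move=> _ [->|[c ->]]; split=> [x _|v].
- exact: ex_diff.
- by exists (cst v); [right; exists v | move=> x _; rewrite derive_id].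
- exact: differentiable_cst.
- by exists (cst 0); [right; exists 0 | move=> x _; rewrite derive_cst].
Qed.

Lemma smooth_on_add V W (U : set V) (f g : V -> W) : open U ->
  smooth_on U f -> smooth_on U g -> smooth_on U (fun x => f x + g x).
Proof.
move=> oU sf sg.
pose P (h : V -> W) := exists f g, [/\ smooth_on U f, smooth_on U g &
  h = fun x => f x + g x].
apply: (@smooth_on_coind _ _ _ P) => //; last by exists f, g.
move=> _ [{sf}f [{sg}g [sf sg ->]]]; split=> [x Ux|v].
  by apply: differentiableD; exact: smooth_on_diff Ux.
exists (fun x => 'D_v f x + 'D_v g x).
  by exists ('D_v f), ('D_v g); split=> //; exact: smooth_on_derive.
by move=> x Ux; apply: derive_add; exact: smooth_on_diff Ux.
Qed.

Lemma smooth_on_sum V W (U : set V) I (r : seq I) (f : I -> V -> W) : open U ->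
  (forall i, smooth_on U (f i)) -> smooth_on U (fun x => \sum_(i <- r) f i x).
Proof.
move=> oU sf; elim: r => [|i r IH].
  under eq_fun do rewrite big_nil.
  exact: smooth_on_cst.
under eq_fun do rewrite big_cons.
exact: smooth_on_add.
Qed.

Lemma smooth_on_clin V W X (U : set V) (l : W -> X) (f : V -> W) : open U ->
  linear l -> continuous l -> smooth_on U f -> smooth_on U (l \o f).
Proof.
move=> oU ll lc sf.
pose P (h : V -> X) := exists2 f, smooth_on U f & h = l \o f.
apply: (@smooth_on_coind _ _ _ P) => //; last by exists f.
move=> _ [{sf}f sf ->]; split=> [x Ux|v].
  by have [] := derive_clin 0 ll lc (smooth_on_diff sf Ux).
exists (l \o 'D_v f); first by exists ('D_v f) => //; exact: smooth_on_derive.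
by move=> x Ux; have [] := derive_clin v ll lc (smooth_on_diff sf Ux).
Qed.

(** The class to which smooth_on_coind applies is rarely that of the maps of
    interest but, by the product rule, that of their finite sums. *)
Inductive sums_of {V W} (B : (V -> W) -> Prop) : (V -> W) -> Prop :=
| sums_of_base f : B f -> sums_of B f
| sums_of_add f g : sums_of B f -> sums_of B g -> sums_of B (fun x => f x + g x).

Lemma sums_of_sum V W (B : (V -> W) -> Prop) I (r : seq I) (f : I -> V -> W) :
  B (fun=> 0) -> (forall i, B (f i)) ->
  sums_of B (fun x => \sum_(i <- r) f i x).
Proof.
move=> B0 Bf; elim: r => [|i r IH].
  under eq_fun do rewrite big_nil.
  exact: sums_of_base.
under eq_fun do rewrite big_cons.
by apply: sums_of_add => //; exact: sums_of_base.
Qed.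

Lemma smooth_on_coind_sums V W (U : set V) (B : (V -> W) -> Prop) : open U ->
  (forall f, B f -> (forall x, U x -> differentiable f x) /\
     forall v, exists2 g, sums_of B g & forall x, U x -> 'D_v f x = g x) ->
  forall f, B f -> smooth_on U f.
Proof.
move=> oU HB f0 /sums_of_base; apply: smooth_on_coind => // {f0} f0.
elim=> {f0} [f /HB//|f g _ [df If] _ [dg Ig]].
split=> [x Ux|v]; first by apply: differentiableD; [exact: df|exact: dg].
have [f' sf' f'E] := If v; have [g' sg' g'E] := Ig v.
exists (fun x => f' x + g' x); first exact: sums_of_add.
by move=> x Ux; rewrite derive_add ?f'E ?g'E//; [exact: df|exact: dg].
Qed.

(** The finite sums of products of smooth maps are stable under derivation, by the
    product rule. *)
Lemma smooth_on_scale V W (U : set V) (f : V -> R^o) (g : V -> W) : open U ->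
  smooth_on U f -> smooth_on U g -> smooth_on U (fun x => f x *: g x).
Proof.
move=> oU sf sg.
pose B (h : V -> W) := exists (f : V -> R^o) (g : V -> W),
  [/\ smooth_on U f, smooth_on U g & h = fun x => f x *: g x].
apply: (smooth_on_coind_sums (B := B)) => //; last by exists f, g.
move=> _ [{sf}f [{sg}g [sf sg ->]]]; split=> [x Ux|v].
  by apply: differentiable_scale; exact: smooth_on_diff Ux.
exists (fun x => 'D_v f x *: g x + f x *: 'D_v g x).
  apply: sums_of_add; apply: sums_of_base.
    by exists ('D_v f), g; split=> //; exact: smooth_on_derive.
  by exists f, ('D_v g); split=> //; exact: smooth_on_derive.
by move=> x Ux; apply: derive_scale; exact: smooth_on_diff Ux.
Qed.

(** A finite-dimensional space given by vectors and coordinate forms. The expansion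
    of vectors writes a differential as a combination of finitely many directional
    derivatives. *)
Definition finite_frame W n (e : 'I_n -> W) (l : 'I_n -> W -> R^o) : Prop :=
  [/\ forall i, linear (l i), forall i, continuous (l i) &
      forall w, w = \sum_i l i w *: e i].

Lemma row_frame m : @finite_frame 'rV[R]_m.+1 m.+1 (delta_mx 0)
  (fun i v => v 0 i).
Proof.
split=> [i a u v|i|w]; first by rewrite !mxE.
  exact: coord_continuous.
exact: row_sum_delta.
Qed.

Lemma real_frame : @finite_frame R^o 1 (fun=> 1) (fun=> id).
Proof.
split=> [i a u v //|i x|w]; first exact: cvg_id.
by rewrite big_ord1 -[LHS]mulr1.
Qed.

Lemma derive_frame V W n (e : 'I_n -> W) (l : 'I_n -> W -> R^o) (f : W -> V) x w :
  finite_frame e l -> differentiable f x ->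
  'D_w f x = \sum_i l i w *: 'D_(e i) f x.
Proof.
move=> [_ _ lE] df; rewrite deriveE // {1}(lE w) linear_sum.
by apply: eq_bigr => i _; rewrite linearZ deriveE.
Qed.

(** By the chain rule, a derivative of f after t is the sum over a frame of the
    products of a coordinate of the derivative of t with a partial derivative of f,
    taken after t. So the finite sums of the a * (b after t), with a and b smooth,
    are stable under derivation. *)
Lemma smooth_on_comp V W X (U : set V) (O : set W) (t : V -> W) (f : W -> X)
    n (e : 'I_n -> W) (l : 'I_n -> W -> R^o) :
  finite_frame e l -> open U ->
  (forall x, U x -> O (t x)) -> smooth_on U t -> smooth_on O f ->
  smooth_on U (f \o t).
Proof.
move=> fr oU UO st sf; have [ll lc lE] := fr.
pose B (h : V -> X) := exists (a : V -> R^o) b, [/\ smooth_on U a, smooth_on O b &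
  h = fun x => a x *: b (t x)].
apply: (smooth_on_coind_sums (B := B)) => //; last first.
  exists (fun=> 1), f; split=> //; first exact: smooth_on_cst.
  by apply/funext => x; rewrite scale1r.
move=> _ [a [{sf}f [sa sf ->]]].
have dft x : U x -> differentiable (f \o t) x.
  move=> Ux; apply: differentiable_comp; first exact: smooth_on_diff Ux.
  exact: smooth_on_diff (UO _ Ux).
split=> [x Ux|v].
  by apply: differentiable_scale (dft x Ux); exact: smooth_on_diff Ux.
exists (fun x => 'D_v a x *: f (t x)
  + \sum_i (a x * l i ('D_v t x)) *: 'D_(e i) f (t x)).
  apply: sums_of_add.
    by apply: sums_of_base; exists ('D_v a), f; split=> //; exact: smooth_on_derive.
  apply: sums_of_sum => [|i].
    exists (fun=> 0), f; split=> //; first exact: smooth_on_cst.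
    by apply/funext => x; rewrite scale0r.
  exists (fun x => a x *: l i ('D_v t x)), ('D_(e i) f); split=> //.
    apply: smooth_on_scale => //; apply: (smooth_on_clin (l := l i)) => //.
    exact: smooth_on_derive.
  exact: smooth_on_derive.
move=> x Ux; have dt := smooth_on_diff st Ux.
have df := smooth_on_diff sf (UO _ Ux).
rewrite (derive_scale _ (smooth_on_diff sa Ux) (dft x Ux)) derive_comp //.
rewrite (derive_frame _ fr df) scaler_sumr; congr (_ + _).
by apply: eq_bigr => i _; rewrite scalerA.
Qed.

End Calculus.

(** * Symmetry of second derivatives *)

Section Schwarz.
Context {R : realType} {V : normedModType R}.
Implicit Types (F : V -> R^o) (x y u v : V).

Lemma line_is_derive F u y (s : R) : differentiable F (s *: u + y) ->
  is_derive s 1 (fun r : R^o => F (r *: u + y)) ('D_u F (s *: u + y)).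
Proof.
move=> dF.
have dl : is_diff (s : R^o) (fun r : R^o => r *: u + y) (fun r => r *: u + 0).
  exact: is_diffD.
have := is_diff_comp dl (differentiableP dF) => -[dc E].
apply: DeriveDef; first exact: diff_derivable.
by rewrite deriveE // E /= scale1r addr0 deriveE.
Qed.

Lemma translate_derive F c x u : differentiable F (c + x) ->
  differentiable (fun z => F (c + z)) x /\
  'D_u (fun z => F (c + z)) x = 'D_u F (c + x).
Proof.
move=> dF.
have ds : is_diff x (fun z => c + z) (fun z => 0 + z) by exact: is_diffD.
have [dt tE] := is_diff_comp ds (differentiableP dF); split=> //.
by rewrite deriveE // tE /= add0r deriveE.
Qed.

Lemma line_mean_value F u y (h : R) : 0 < h ->
  (forall s, 0 <= s <= h -> differentiable F (s *: u + y)) ->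
  exists2 c, 0 <= c <= h & F (h *: u + y) - F y = h * 'D_u F (c *: u + y).
Proof.
move=> h0 dF.
have [||c ch] := @MVT _ (fun r => F (r *: u + y))
    (fun r => 'D_u F (r *: u + y)) 0 h h0.
- move=> s; rewrite in_itv /= => /andP[s0 sh]; apply: line_is_derive.
  by apply: dF; rewrite !ltW.
- apply: continuous_in_subspaceT => s; rewrite inE /= in_itv /= => /dF dFs.
  have [/derivable1_diffP dl _] := line_is_derive dFs.
  exact: differentiable_continuous dl.
- rewrite scale0r add0r subr0 mulrC => E; exists c => //.
  by move: ch; rewrite in_itv /= => /andP[c0 ch]; rewrite !ltW.
Qed.

(** The mean value theorem is applied in the direction u to the increments of F by h
    v, and then in the direction v to the derivative of F along u. *)
Lemma second_difference F (U : set V) x u v (h : R) : smooth_on U F -> 0 < h ->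
  (forall s t, 0 <= s <= h -> 0 <= t <= h -> U (s *: u + (t *: v + x))) ->
  exists s t, [/\ 0 <= s <= h, 0 <= t <= h &
    F (h *: u + (h *: v + x)) - F (h *: u + x) - (F (h *: v + x) - F x)
    = h * (h * 'D_v ('D_u F) (s *: u + (t *: v + x)))].
Proof.
move=> sF h0 HU.
have dF s t : 0 <= s <= h -> 0 <= t <= h ->
    differentiable F (s *: u + (t *: v + x)).
  by move=> sh th; apply: smooth_on_diff sF _; exact: HU.
have h00 : (0 : R) <= (0 : R) <= h by rewrite lexx ltW.
have hhh : 0 <= h <= h by apply/andP; split=> //; exact: ltW.
have dF' s : 0 <= s <= h -> differentiable F (s *: u + x).
  by move=> sh; have := dF s 0 sh h00; rewrite scale0r add0r.
pose G z := F (h *: v + z) - F z.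
have dG s : 0 <= s <= h -> differentiable G (s *: u + x) /\
    'D_u G (s *: u + x) = 'D_u F (h *: v + (s *: u + x)) - 'D_u F (s *: u + x).
  move=> sh; have ds := dF s h sh hhh; rewrite addrCA in ds.
  have [dt tE] := translate_derive u ds.
  split; first by apply: differentiableB => //; exact: dF'.
  by rewrite deriveB ?tE //; apply: diff_derivable => //; exact: dF'.
have [|s sh Es] := @line_mean_value G u x h h0.
  by move=> s sh; have [] := dG s sh.
have [|t th Et] := @line_mean_value ('D_u F) v (s *: u + x) h h0.
  move=> t th; apply: (@smooth_on_diff _ _ _ U); first exact: smooth_on_derive.
  by rewrite addrCA; exact: HU.
exists s, t; split=> //.
rewrite [s *: u + _]addrCA -Et addrCA -/(G (h *: u + x)) -/(G x) Es.
by have [_ ->] := dG s sh.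
Qed.

Let dist_lt_halves (a b c e : R) :
  `|a - c| < e / 2 -> `|b - c| < e / 2 -> `|a - b| <= e.
Proof.
move=> Ha Hb; rewrite (splitr e) -(subrKA c) (le_trans (ler_normD _ _)) //.
by rewrite lerD // ltW // distrC.
Qed.

Let second_difference_eq (h a b p q r w : R) : h != 0 ->
  p - q - (r - w) = h * (h * a) -> p - r - (q - w) = h * (h * b) -> a = b.
Proof.
move=> h0 Ea Eb; apply: (mulfI h0); apply: (mulfI h0).
by rewrite -Ea -Eb; ring.
Qed.

(** Both mixed derivatives are limits of the same second difference, which is
    symmetric in u and v, because both are continuous at x. *)
Lemma derive_comm F (U : set V) x u v : open U -> U x -> smooth_on U F ->
  'D_u ('D_v F) x = 'D_v ('D_u F) x.
Proof.
move=> oU Ux sF; apply/eqP; rewrite -subr_eq0 -normr_le0.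
apply/ler_addgt0Pl => /= e e0; rewrite addr0.
have cA := differentiable_continuous
  (smooth_on_diff (smooth_on_derive u (smooth_on_derive v sF)) Ux).
have cB := differentiable_continuous
  (smooth_on_diff (smooth_on_derive v (smooth_on_derive u sF)) Ux).
have e2 : 0 < e / 2 by rewrite divr_gt0.
have nU : \forall y \near x, U y by exact: (open_nbhs_nbhs (conj oU Ux)).
have nA : \forall y \near x, `|'D_u ('D_v F) x - 'D_u ('D_v F) y| < e / 2.
  by move/cvgrPdist_lt : cA => /(_ _ e2).
have nB : \forall y \near x, `|'D_v ('D_u F) x - 'D_v ('D_u F) y| < e / 2.
  by move/cvgrPdist_lt : cB => /(_ _ e2).
have /nbhs_ballP [d /= d0 Hd] : \forall y \near x, U y /\
    (`|'D_u ('D_v F) x - 'D_u ('D_v F) y| < e / 2 /\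
     `|'D_v ('D_u F) x - 'D_v ('D_u F) y| < e / 2).
  exact: (filterI nU (filterI nA nB)).
(* With h = d / (2 m), the points s u + t v + x with s, t <= h are in the ball. *)
pose m := `|u| + `|v| + 1.
have m0 : 0 < m by rewrite ltr_wpDl // addr_ge0.
pose h := d / (2 * m).
have h0 : 0 < h by rewrite divr_gt0 // mulr_gt0.
have Hst s t : 0 <= s <= h -> 0 <= t <= h -> ball x d (s *: u + (t *: v + x)).
  move=> /andP[s0 sh] /andP[t0 th]; rewrite -ball_normE /= addrA opprD addrCA.
  rewrite subrr addr0 normrN (le_lt_trans (ler_normD _ _)) // !normrZ !ger0_norm//.
  apply: (@le_lt_trans _ _ (h * (`|u| + `|v|))).
    by rewrite mulrDr lerD // ler_wpM2r.
  apply: (@lt_trans _ _ (h * m)); first by rewrite ltr_pM2l // /m ltrDl.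
  have -> : h * m = d / 2 by rewrite /h invfM mulrA divfK // gt_eqF.
  by rewrite ltr_pdivrMr // mulrC ltr_pMl // ltr1n.
have Hts s t : 0 <= s <= h -> 0 <= t <= h -> ball x d (s *: v + (t *: u + x)).
  by move=> sh th; rewrite addrCA; exact: Hst.
have [|s [t [sh th E1]]] := second_difference (u := u) (v := v) (x := x) sF h0.
  by move=> s t sh th; have [] := Hd _ (Hst _ _ sh th).
have [|s' [t' [sh' th' E2]]] := second_difference (u := v) (v := u) (x := x) sF h0.
  by move=> s' t' sh' th'; have [] := Hd _ (Hts _ _ sh' th').
have E : 'D_v ('D_u F) (s *: u + (t *: v + x))
       = 'D_u ('D_v F) (s' *: v + (t' *: u + x)).
  rewrite [h *: v + (h *: u + x)]addrCA in E2.
  exact: (second_difference_eq (lt0r_neq0 h0) E1 E2).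
have [_ [_ H1]] := Hd _ (Hst _ _ sh th).
have [_ [H2 _]] := Hd _ (Hts _ _ sh' th').
by rewrite E in H1; exact: (dist_lt_halves H2 H1).
Qed.

End Schwarz.

(** * Bump functions *)

Section Flat.
Context {R : realType}.
Implicit Types (p : {poly R}) (x : R).

(** From x / n <= exp (x / n), raised to the power n. *)
Lemma pow_le_expR n x : 0 <= x -> x ^+ n <= n%:R ^+ n * expR x.
Proof.
case: n => [|n] x0.
  by rewrite !expr0 mul1r (le_trans _ (expR_ge1Dx x)) // lerDl.
have n0 : n.+1%:R != 0 :> R by rewrite pnatr_eq0.
rewrite -{1 2}(divfK n0 x) -[expR (_ * _)]/(expR _) mulrC expRM_natl exprMn.
rewrite ler_wpM2l ?exprn_ge0 // lerXn2r ?nnegrE ?divr_ge0 ?expR_ge0 //.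
by rewrite (le_trans _ (expR_ge1Dx _)) // lerDr.
Qed.

Lemma horner_le_expR p :
  exists2 C, 0 <= C & forall x, 0 <= x -> `|p.[x]| <= C * expR x.
Proof.
exists (\sum_(i < size p) `|p`_i| * i%:R ^+ i).
  by apply: sumr_ge0 => i _; rewrite mulr_ge0 ?exprn_ge0.
move=> x x0; rewrite horner_coef (le_trans (ler_norm_sum _ _ _)) //.
rewrite mulr_suml ler_sum // => i _; rewrite normrM -mulrA ler_wpM2l //.
by rewrite ger0_norm ?exprn_ge0 // pow_le_expR.
Qed.

(** The flat functions p(1/x) exp(-1/x) on x > 0. Arbitrary polynomials p are
    allowed so that the class is stable under derivation. *)
Definition flat p (x : R^o) : R^o := if 0 < x then p.[x^-1] * expR (- x^-1) else 0.

(** A quadratic bound near 0, which makes the derivative at 0 vanish; it says that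
    y^2 p(y) is dominated by exp y. *)
Lemma flat_le_sqr p : exists2 C, 0 <= C & forall x, `|flat p x| <= C * x ^+ 2.
Proof.
have [C C0 HC] := horner_le_expR ('X^2 * p).
exists C => // x; rewrite /flat; case: ifPn => [x0|_]; last first.
  by rewrite normr0 mulr_ge0 // sqr_ge0.
rewrite normrM (ger0_norm (expR_ge0 _)) expRN ler_pdivrMr ?expR_gt0 //.
have xV0 : 0 <= x^-1 by rewrite invr_ge0 ltW.
have := HC _ xV0; rewrite hornerM hornerXn normrM ger0_norm ?exprn_ge0 //.
by rewrite exprVn ler_pdivrMl ?exprn_gt0 // mulrCA mulrA.
Qed.

Let deriv_step p : {poly R} := 'X^2 * (p - p^`()).

Let inv_is_derive (x : R) : x != 0 ->
  is_derive x 1 (fun y : R => y^-1) (- x^-2).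
Proof.
move=> xn0; apply: (is_derive_eq (@is_deriveV R id x 1 1 xn0 (is_derive_id _ _))).
by rewrite /GRing.scale /= mulr1.
Qed.

(** On x > 0, with y = 1/x, the derivative of p(y) exp(-y) is y^2 (p(y) - p'(y))
    exp(-y). *)
Lemma flat_is_derive p (x : R^o) : is_derive x 1 (flat p) (flat (deriv_step p) x).
Proof.
have [x0|x0|->] := ltgtP x 0.
- rewrite {2}/flat ltNge (ltW x0) /=.
  apply: (near_eq_is_derive (f := cst 0)).
  by near=> y; rewrite /flat ltNge ltW //=; near: y; exact: lt_nbhsl.
- pose f (y : R) : R := p.[y^-1] * expR (- y^-1).
  apply: (near_eq_is_derive (f := f)).
    near=> y; rewrite /flat ifT //; near: y; exact: lt_nbhsr.
  have xn0 : x != 0 by rewrite gt_eqF.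
  have dV := inv_is_derive xn0.
  have dN : is_derive (x : R) 1 (fun y : R => - y^-1) (x^-2).
    by apply: (is_derive_eq (is_deriveN dV)); rewrite opprK.
  have dp := is_derive1_comp (is_derive_poly p x^-1) dV.
  have de := @is_derive1_comp _ expR (fun y : R => - y^-1) _ _ _
    (is_derive_expR (- x^-1)) dN.
  apply: (is_derive_eq (is_deriveM dp de)).
  rewrite /flat x0 /deriv_step /= !hornerE /GRing.scale /= exprVn; ring.
rewrite {2}/flat ltxx.
have [C C0 HC] := flat_le_sqr p.
have f0 : flat p 0 = 0 by rewrite /flat ltxx.
have cv : (fun h : R => h^-1 *: ((flat p \o shift (0 : R^o)) (h *: 1) - flat p 0))
    @ 0^' --> (0 : R^o).
  apply/cvgrPdist_le => e e0; near=> h.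
  have hn0 : h != 0 by near: h; exact: nbhs_dnbhs_neq.
  rewrite sub0r normrN f0 subr0 /= addr0 [h *: 1]mulr1 normrM normfV.
  rewrite ler_pdivrMl ?normr_gt0 // (le_trans (HC h)) // -real_normK ?num_real //.
  rewrite expr2 mulrCA ler_wpM2l //.
  apply: (@le_trans _ _ ((C + 1) * `|h|)); first by rewrite ler_wpM2r // lerDl.
  rewrite -ler_pdivlMl ?ltr_wpDl //.
  by near: h; apply: dnbhs0_le; rewrite mulr_gt0 // invr_gt0 ltr_wpDl.
apply: DeriveDef; first by apply/cvg_ex; exists 0.
exact: cvg_lim cv.
Unshelve. all: by end_near. Qed.

Lemma flat_smooth p : smooth_on setT (flat p).
Proof.
apply: (smooth_on_coind (P := fun f => exists p, f = flat p)); last by exists p.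
  exact: openT.
move=> _ [{}p ->].
have df x : differentiable (flat p) x.
  by apply/derivable1_diffP; have [] := flat_is_derive p x.
split=> // v; exists (flat (v *: deriv_step p)); first by eexists.
move=> x _; rewrite deriveE // -[v in LHS]mulr1 linearZ -deriveE //.
have [_ ->] := flat_is_derive p x; rewrite /flat; case: ifP => _; last first.
  exact: scaler0.
by rewrite hornerZ -mulrA.
Qed.

(** The functions p(1/x) are stable under derivation on the nonzero reals. *)
Lemma inv_smooth : smooth_on [set x : R^o | x != 0] (fun x : R^o => x^-1 : R^o).
Proof.
pose f p (x : R^o) : R^o := p.[x^-1].
suff : smooth_on [set x : R^o | x != 0] (f 'X).
  by congr smooth_on; apply/funext => x; rewrite /f hornerX.
apply: (smooth_on_coind (P := fun g => exists p, g = f p)); last by exists 'X.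
  exact: (@open_neq _ 0).
move=> _ [p ->].
have df x : x != 0 -> is_derive (x : R) 1 (f p) (f (- 'X^2 * p^`()) x).
  move=> xn0.
  have dV := inv_is_derive xn0.
  apply: (is_derive_eq (is_derive1_comp (is_derive_poly p x^-1) dV)).
  by rewrite /f !hornerE exprVn; ring.
have dif x : x != 0 -> differentiable (f p) x.
  by move=> /df[? _]; apply/derivable1_diffP.
split=> // v; exists (f (v *: (- 'X^2 * p^`()))); first by eexists.
move=> x xn0; rewrite (deriveE _ (dif x xn0)) -[v in LHS]mulr1 linearZ.
rewrite -(deriveE _ (dif x xn0)).
by have [_ ->] := df x xn0; rewrite /f hornerZ.
Qed.

Let sqr_le_itv (x a r : R) : 0 < r -> (x - a) ^+ 2 <= r ^+ 2 ->
  x \in `[a - r, a + r].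
Proof.
move=> r0; rewrite -ler_sqrt ?sqr_ge0 // !sqrtr_sqr (ger0_norm (ltW r0)).
by rewrite ler_norml in_itv /= => /andP[H1 H2]; apply/andP; split; lra.
Qed.

(** The function exp (-1 / N) with N = r^2 - |x - a|^2, cut at N = 0. It is
    supported in the Euclidean ball of radius r, hence in the cube with the same
    centre. *)
Lemma exists_bump m (a : 'rV[R]_m.+1) (r : R) : 0 < r ->
  exists b : 'rV[R]_m.+1 -> R^o, [/\ smooth_on setT b, b a != 0 &
    forall y, b y != 0 -> forall i, y 0 i \in `[a 0 i - r, a 0 i + r]].
Proof.
move=> r0.
pose N (x : 'rV[R]_m.+1) : R^o := r ^+ 2 - \sum_i (x 0 i - a 0 i) ^+ 2.
have sN : smooth_on setT N.
  rewrite (_ : N = fun y => r ^+ 2 +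
      \sum_i (- (y 0 i - a 0 i) : R^o) *: (y 0 i - a 0 i : R^o)); last first.
    apply/funext => y; rewrite /N; congr (_ + _); rewrite -sumrN.
    by apply: eq_bigr => i _; rewrite expr2 -mulNr.
  have sc i : smooth_on setT (fun x : 'rV[R]_m.+1 => x 0 i - a 0 i : R^o).
    apply: smooth_on_add; [exact: openT | | exact/smooth_on_cst/openT].
    have [ll lc _] := @row_frame R m.
    apply: (smooth_on_clin (l := fun v : 'rV[R]_m.+1 => v 0 i : R^o) (f := id)).
    + exact: openT.
    + exact: ll.
    + exact: lc.
    + exact/smooth_on_id/openT.
  apply: smooth_on_add; [exact: openT | exact/smooth_on_cst/openT |].
  apply: smooth_on_sum; [exact: openT | move=> i].
  apply: smooth_on_scale; [exact: openT | | exact: sc].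
  rewrite (_ : (fun _ => _) = fun x : 'rV[R]_m.+1 => (-1 : R^o) *: (x 0 i - a 0 i : R^o)).
    by apply: smooth_on_scale; [exact: openT | exact/smooth_on_cst/openT | exact: sc].
  by apply/funext => y; rewrite scaleN1r.
exists (flat 1 \o N); split.
- apply: (smooth_on_comp (O := setT) (@real_frame R)) => //; first exact: openT.
  exact: flat_smooth.
- rewrite /= /N big1 ?subr0; last by move=> i _; rewrite subrr expr0n.
  rewrite /flat exprn_gt0 // hornerC mul1r gt_eqF //; exact: expR_gt0.
- move=> y; rewrite /= /flat; case: ifPn => [Ny _ i|]; last by rewrite eqxx.
  have : (y 0 i - a 0 i) ^+ 2 <= r ^+ 2.
    move: Ny; rewrite /N subr_gt0 => /ltW; apply: le_trans.
    rewrite (bigD1 i) //= lerDl; apply: sumr_ge0 => j _; exact: sqr_ge0.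
  exact: sqr_le_itv.
Qed.

End Flat.

(** * Charts, smooth functions and vector fields *)

(** The derivative of f along X is the combination of its partial derivatives with
    the components of X as coefficients. *)
Lemma smooth_on_derive_along {R : realType} {m : nat} {W : normedModType R}
    (U : set 'rV[R]_m.+1) (f : 'rV[R]_m.+1 -> W) (X : 'rV[R]_m.+1 -> 'rV[R]_m.+1) :
  open U -> smooth_on U f -> smooth_on U X -> smooth_on U (fun y => 'D_(X y) f y).
Proof.
move=> oU sf sX.
apply: (smooth_on_eq
  (g := fun y => \sum_i (X y 0 i : R^o) *: 'D_(delta_mx 0 i) f y)) => //.
  by move=> y Uy; rewrite (derive_frame _ (@row_frame R m) (smooth_on_diff sf Uy)).
have [ll lc _] := @row_frame R m.
apply: smooth_on_sum => // i; apply: smooth_on_scale => //.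
  exact: (smooth_on_clin oU (ll i) (lc i) sX).
exact: smooth_on_derive.
Qed.

Section ManifoldTheory.
Context {R : realType} {m : nat} {M : topologicalType}.
Local Notation E := ('rV[R]_m.+1).
Variable A : M -> chart M E.
Hypothesis mfd : smooth_manifold A.

Local Notation dom p := (chart_dom (A p)).
Local Notation img p := (chart_img (A p)).
Local Notation cm p := (chart_map (A p)).
Local Notation ci p := (chart_inv (A p)).

Lemma chart_at p : is_chart (A p). Proof. by case: mfd => _ _ _ /(_ p)[]. Qed.
Lemma dom_self p : dom p p. Proof. by case: mfd => _ _ _ /(_ p)[]. Qed.
Lemma dom_open p : open (dom p). Proof. by case: (chart_at p). Qed.
Lemma img_open p : open (img p). Proof. by case: (chart_at p). Qed.
Arguments dom_open : clear implicits.
Arguments img_open : clear implicits.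

Lemma ciK p q : dom p q -> ci p (cm p q) = q.
Proof. by case: (chart_at p) => _ _ H _ _; exact: H. Qed.
Lemma img_cm p q : dom p q -> img p (cm p q). Proof. by exists q. Qed.
Lemma dom_ci p y : img p y -> dom p (ci p y).
Proof. by move=> [q pq <-]; rewrite ciK. Qed.
Lemma cmK p y : img p y -> cm p (ci p y) = y.
Proof. by move=> [q pq <-]; rewrite ciK. Qed.

(** The inverse of a chart is continuous on its open domain. *)
Lemma near_ci p y (B : set M) : img p y -> open B -> B (ci p y) ->
  \forall z \near y, img p z /\ B (ci p z).
Proof.
move=> py oB By; have H1 : nbhs y (img p) := open_nbhs_nbhs (conj (img_open p) py).
apply: filterI; first exact: H1.
case: (chart_at p) => _ oi _ _; rewrite continuous_open_subspace // => ci_cont.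
have := ci_cont y; rewrite inE => /(_ py); apply.
exact: (open_nbhs_nbhs (conj oB By)).
Qed.

(** The domain of the change of charts from the chart at p to that at q. *)
Definition overlap p q : set E := [set y | img p y /\ dom q (ci p y)].

Lemma overlap_open p q : open (overlap p q).
Proof.
rewrite openE => y [py qy]; exact: near_ci py (dom_open q) qy.
Qed.

Arguments overlap_open : clear implicits.

Lemma overlap_cm p q x : dom p x -> dom q x -> overlap p q (cm p x).
Proof. by move=> px qx; split; [exact: img_cm | rewrite ciK]. Qed.

Lemma transition_smooth p q : smooth_on (overlap p q) (cm q \o ci p).
Proof.
case: mfd => _ _ _ _ /(_ p q); apply: smooth_on_sub => y [py qy].
by exists (ci p y); [split=> //; exact: dom_ci | exact: cmK].
Qed.

Arguments transition_smooth : clear implicits.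

Lemma transition_overlap p q y : overlap p q y -> overlap q p (cm q (ci p y)).
Proof. by move=> [py qy]; apply: overlap_cm => //; exact: dom_ci. Qed.

(** Tangent vectors at x are vectors of E in any chart around x; this is the
    differential of the change of charts, which relates the components in the charts
    at p and at q. *)
Definition transport p q (x : M) (v : E) : E := 'D_v (cm q \o ci p) (cm p x).

Lemma transition_diff p q x : dom p x -> dom q x ->
  differentiable (cm q \o ci p) (cm p x).
Proof.
by move=> px qx; apply: smooth_on_diff (transition_smooth p q) _; exact: overlap_cm.
Qed.

Lemma near_overlap p q x : dom p x -> dom q x -> \forall z \near cm p x, overlap p q z.
Proof.
move=> px qx; apply: (open_nbhs_nbhs (conj (overlap_open p q) _)).
exact: overlap_cm.
Qed.

(** The chain rule for the change of charts, f being expressed in the charts at p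
    and at q. *)
Lemma derive_change_chart {W : normedModType R} p q x (f : M -> W) v :
  dom p x -> dom q x -> differentiable (f \o ci q) (cm q x) ->
  'D_v (f \o ci p) (cm p x) = 'D_(transport p q x v) (f \o ci q) (cm q x).
Proof.
move=> px qx df.
have -> : 'D_v (f \o ci p) (cm p x) = 'D_v ((f \o ci q) \o (cm q \o ci p)) (cm p x).
  apply: near_eq_derive; apply: filterS (near_overlap px qx) => z [pz qz] /=.
  by rewrite ciK.
rewrite derive_comp /=; first by rewrite ciK.
  exact: transition_diff.
by rewrite ciK.
Qed.

(** The cocycle rule, which is the chain rule for the changes of charts. *)
Lemma transport_comp p q r x v : dom p x -> dom q x -> dom r x ->
  transport q r x (transport p q x v) = transport p r x v.
Proof.
move=> px qx rx; rewrite /transport [RHS](derive_change_chart _ px qx) //.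
exact: transition_diff.
Qed.

Lemma transport_id p x v : dom p x -> transport p p x v = v.
Proof.
move=> px; rewrite /transport -[RHS](derive_id (cm p x)).
apply: near_eq_derive; apply: filterS (near_overlap px px) => z [pz _] /=.
exact: cmK.
Qed.

Lemma transport_linear p q x : dom p x -> dom q x -> linear (transport p q x).
Proof. by move=> px qx a u v; apply: derive_linear; exact: transition_diff. Qed.

Lemma readE p X y : read A p X y = transport (ci p y) p (ci p y) (X (ci p y)).
Proof. by []. Qed.

(** In the chart at x itself the components of X x are X x, so reading X in the
    chart at p is transport from x to p. *)
Lemma read_cm p X x : dom p x -> read A p X (cm p x) = transport x p x (X x).
Proof. by move=> px; rewrite readE ciK. Qed.

Lemma read_self p X : read A p X (cm p p) = X p.
Proof. by rewrite read_cm ?transport_id //; exact: dom_self. Qed.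

Lemma read_change p q X x : dom p x -> dom q x ->
  read A q X (cm q x) = transport p q x (read A p X (cm p x)).
Proof. move=> px qx; rewrite (read_cm X px) (read_cm X qx).
by rewrite (transport_comp _ (dom_self x) px qx). Qed.

Lemma read_inv p X x : dom p x -> X x = transport p x x (read A p X (cm p x)).
Proof.
by move=> px; rewrite -read_change ?read_self //; exact: dom_self.
Qed.

Lemma read_lin p (f : M -> R^o) X Y y : img p y ->
  read A p (fun q => f q *: X q + Y q) y =
  f (ci p y) *: read A p X y + read A p Y y.
Proof.
by move=> py; rewrite !readE transport_linear //; [exact: dom_self | exact: dom_ci].
Qed.

Lemma read_local p X Y y : X (ci p y) = Y (ci p y) -> read A p X y = read A p Y y.
Proof. by rewrite !readE => ->. Qed.

Lemma smooth_vf_lin f X Y : smooth_fun A f -> smooth_vf A X -> smooth_vf A Y ->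
  smooth_vf A (fun q => f q *: X q + Y q).
Proof.
move=> sf sX sY p.
apply: (smooth_on_eq (g := fun y => (f \o ci p) y *: read A p X y + read A p Y y)).
- exact: img_open.
- by move=> y py; rewrite read_lin.
- apply: smooth_on_add; [exact: img_open | | exact: (sY p)].
  by apply: smooth_on_scale; [exact: img_open | exact: (sf p) | exact: (sX p)].
Qed.

Lemma smooth_fun_cst c : smooth_fun A (fun=> c).
Proof. by move=> p; apply: smooth_on_cst; exact: img_open. Qed.

Lemma smooth_fun_add f g : smooth_fun A f -> smooth_fun A g ->
  smooth_fun A (fun x => f x + g x).
Proof.
move=> sf sg p.
by apply: smooth_on_add; [exact: img_open | exact: (sf p) | exact: (sg p)].
Qed.

Lemma smooth_fun_mul f g : smooth_fun A f -> smooth_fun A g ->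
  smooth_fun A (fun x => f x * g x).
Proof.
move=> sf sg p.
by apply: smooth_on_scale; [exact: img_open | exact: (sf p) | exact: (sg p)].
Qed.

Lemma smooth_vf0 : smooth_vf A (fun=> 0).
Proof.
move=> p; apply: (smooth_on_eq (g := fun=> 0)); first exact: img_open.
  by move=> y py; rewrite readE /transport derive0.
exact/smooth_on_cst/img_open.
Qed.

Lemma smooth_fun_diff f p x : smooth_fun A f -> dom p x ->
  differentiable (f \o ci p) (cm p x).
Proof. by move=> sf px; apply: smooth_on_diff (sf p) _; exact: img_cm. Qed.

(** The derivative of f along X can be computed in any chart. *)
Lemma act_read p X f x : smooth_fun A f -> dom p x ->
  act A X f x = 'D_(read A p X (cm p x)) (f \o ci p) (cm p x).
Proof.
move=> sf px; rewrite read_cm // -derive_change_chart //; first exact: dom_self.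
exact: smooth_fun_diff.
Qed.

Lemma act_ci p X f y : smooth_fun A f -> img p y ->
  act A X f (ci p y) = 'D_(read A p X y) (f \o ci p) y.
Proof.
by move=> sf py; rewrite (act_read _ sf (dom_ci py)) cmK.
Qed.

Lemma smooth_fun_act X f : smooth_vf A X -> smooth_fun A f ->
  smooth_fun A (act A X f).
Proof.
move=> sX sf p; apply: (smooth_on_eq (g := fun y => 'D_(read A p X y) (f \o ci p) y)).
- exact: img_open.
- by move=> y py /=; rewrite act_ci.
- by apply: smooth_on_derive_along; [exact: img_open | exact: (sf p) | exact: (sX p)].
Qed.

Lemma act_add X f g x : smooth_fun A f -> smooth_fun A g ->
  act A X (fun q => f q + g q) x = act A X f x + act A X g x.
Proof.
move=> sf sg; apply: (derive_add (f := f \o ci x) (g := g \o ci x));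
  exact/smooth_fun_diff/dom_self.
Qed.

Lemma act_mul X f g x : smooth_fun A f -> smooth_fun A g ->
  act A X (fun q => f q * g q) x = act A X f x * g x + f x * act A X g x.
Proof.
move=> sf sg; rewrite /act.
have := @derive_scale _ _ _ (f \o ci x) (g \o ci x) (cm x x) (X x).
move=> /(_ (smooth_fun_diff sf (dom_self x)) (smooth_fun_diff sg (dom_self x))).
by rewrite /= ciK //; exact: dom_self.
Qed.

Lemma act_cst X c x : act A X (fun=> c) x = 0.
Proof. exact: (derive_cst c). Qed.

Lemma act_sub X f g x : smooth_fun A f -> smooth_fun A g ->
  act A X (fun q => f q - g q) x = act A X f x - act A X g x.
Proof.
move=> sf sg; apply: (deriveB (f := f \o ci x) (g := g \o ci x));
  exact/diff_derivable/smooth_fun_diff/dom_self.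
Qed.

Lemma act_vf_add X Y f x : smooth_fun A f ->
  act A (fun q => X q + Y q) f x = act A X f x + act A Y f x.
Proof.
move=> sf; have d := smooth_fun_diff sf (dom_self x).
by rewrite /act !(deriveE _ d) linearD.
Qed.

(** * Extension by zero, cutoff functions and local frames *)

Section Glue.
Variables (p : M) (C : set M).
Hypotheses (cC : closed C) (Cp : C `<=` dom p).

(** Where a point is outside the domain of the chart it is in the complement of the
    closed set C, which is open and where f vanishes. *)
Lemma glue_smooth_fun f : (forall z, ~ C z -> f z = 0) ->
  smooth_on (img p) (f \o ci p) -> smooth_fun A f.
Proof.
move=> f0 sf r; apply: smooth_on_near => y ry.
have [py|npy] := pselect (dom p (ci r y)).
  exists (overlap r p), ((f \o ci p) \o (cm p \o ci r)); split; first by split.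
    apply: (smooth_on_comp (@row_frame R m)); last exact: sf.
    - exact: overlap_open.
    - by move=> z [rz pz]; exact: img_cm.
    - exact: transition_smooth.
  apply: filterS (near_ci ry (dom_open p) py) => z [rz pz] /=.
  by rewrite ciK.
have Cy : (~` C) (ci r y) by move=> /Cp.
exists setT, (fun=> 0); split=> //; first exact/smooth_on_cst/openT.
by apply: filterS (near_ci ry (closed_openC cC) Cy) => z [rz Cz] /=; rewrite f0.
Qed.

(** As for functions; on the overlap of two charts the components are transported by
    the smooth differential of the change of charts. *)
Lemma glue_smooth_vf X : (forall z, ~ C z -> X z = 0) ->
  smooth_on (img p) (read A p X) -> smooth_vf A X.
Proof.
move=> X0 sX r; apply: smooth_on_near => y ry.
have [py|npy] := pselect (dom p (ci r y)).
  exists (overlap r p), ((fun z => 'D_(read A p X z) (cm r \o ci p) z)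
    \o (cm p \o ci r)); split; first by split.
    apply: (smooth_on_comp (@row_frame R m) (O := overlap p r)).
    - exact: overlap_open.
    - by move=> z; exact: transition_overlap.
    - exact: transition_smooth.
    - apply: smooth_on_derive_along; first exact: overlap_open.
        exact: transition_smooth.
      by apply: smooth_on_sub sX => z [].
  apply: filterS (near_ci ry (dom_open p) py) => z [rz pz] /=.
  by have := read_change X pz (dom_ci rz); rewrite (cmK rz) => ->.
have Cy : (~` C) (ci r y) by move=> /Cp.
exists setT, (fun=> 0); split=> //; first exact/smooth_on_cst/openT.
apply: filterS (near_ci ry (closed_openC cC) Cy) => z [rz Cz] /=.
by rewrite readE X0 // /transport derive0.
Qed.

End Glue.

Definition cutoff p (rho : M -> R^o) : Prop := smooth_fun A rho /\
  exists C, [/\ closed C, C `<=` dom p & forall z, ~ C z -> rho z = 0].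

(** A bump function supported in a cube K inside the image of the chart, extended by
    zero. K is compact, so its image in M is compact, hence closed because M is
    Hausdorff. *)
Lemma exists_cutoff p x : dom p x -> exists2 rho, cutoff p rho & rho x != 0.
Proof.
move=> px.
have /nbhs_ballP[e /= e0 He] : nbhs (cm p x) (img p).
  exact: (open_nbhs_nbhs (conj (img_open p) (img_cm px))).
have r0 : 0 < e / 2 by rewrite divr_gt0.
have [b [sb bx Hb]] := exists_bump (cm p x) r0.
pose K := [set v : E | forall i, v 0 i \in `[cm p x 0 i - e / 2, cm p x 0 i + e / 2]].
have cK : compact K.
  apply: (@rV_compact _ _ (fun i => `[cm p x 0 i - e / 2, cm p x 0 i + e / 2]%classic)).
  by move=> i; exact: segment_compact.
have Kp : K `<=` img p.
  move=> v Kv; apply: He; rewrite -ball_normE /= /Num.Def.normr /= mx_normrE.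
  apply: bigmax_lt => // -[i j] _; rewrite !mxE /= (ord1 i).
  have := Kv j; rewrite in_itv /= => /andP[H1 H2].
  by rewrite ltr_norml; apply/andP; split; lra.
have cC : compact (ci p @` K).
  apply: continuous_compact => //; apply: continuous_subspaceW Kp _.
  by case: (chart_at p).
pose rho z : R^o := if pselect (dom p z) then b (cm p z) else 0.
have C0 z : ~ (ci p @` K) z -> rho z = 0.
  rewrite /rho; case: pselect => // pz nK; apply/eqP/negPn/negP => bz.
  by apply: nK; exists (cm p z); [exact: Hb | exact: ciK].
have Cp : ci p @` K `<=` dom p by move=> _ [v /Kp /dom_ci ? <-].
have cC' : closed (ci p @` K) by apply: compact_closed cC; case: mfd.
exists rho; last by rewrite /rho; case: pselect.
split; last by exists (ci p @` K).
apply: (glue_smooth_fun cC' Cp C0).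
apply: (smooth_on_eq (g := b)); first exact: img_open.
  by move=> y py; rewrite /rho /=; case: pselect => [?|/(_ (dom_ci py))//];
    rewrite cmK.
exact: smooth_on_sub sb.
Qed.

Lemma cutoff_smooth_fun p rho (f : E -> R^o) : cutoff p rho ->
  smooth_on (img p) f -> smooth_fun A (fun z => rho z * f (cm p z)).
Proof.
move=> [sr [C [cC Cp r0]]] sf; apply: (glue_smooth_fun cC Cp) => [z Cz|].
  by rewrite r0 // mul0r.
apply: (smooth_on_eq (g := fun y => (rho \o ci p) y *: f y)).
- exact: img_open.
- by move=> y py /=; rewrite cmK.
- by apply: smooth_on_scale; [exact: img_open | exact: (sr p) | exact: sf].
Qed.

(** The vector field whose components in the chart at p are rho times F; the
    vanishing of rho makes the values of F and of the chart outside the domain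
    irrelevant. *)
Definition cutoff_vf p (rho : M -> R^o) (F : E -> E) (z : M) : E :=
  rho z *: transport p z z (F (cm p z)).

Lemma read_cutoff_vf p rho F y : img p y ->
  read A p (cutoff_vf p rho F) y = rho (ci p y) *: F y.
Proof.
move=> py; have pz := dom_ci py; have zz := dom_self (ci p y).
rewrite readE /cutoff_vf -[_ *: _]addr0 transport_linear // transport_comp //.
by rewrite transport_id // cmK // [transport _ _ _ 0]derive0 addr0.
Qed.

Lemma cutoff_vf_smooth p rho (F : E -> E) : cutoff p rho ->
  smooth_on (img p) F -> smooth_vf A (cutoff_vf p rho F).
Proof.
move=> [sr [C [cC Cp r0]]] sF; apply: (glue_smooth_vf cC Cp) => [z Cz|].
  by rewrite /cutoff_vf r0 // scale0r.
apply: (smooth_on_eq (g := fun y => (rho \o ci p) y *: F y)).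
- exact: img_open.
- by move=> y py /=; rewrite read_cutoff_vf.
- by apply: smooth_on_scale; [exact: img_open | exact: (sr p) | exact: sF].
Qed.

Lemma linear_sumZ {V W : lmodType R} (l : V -> W) n (a : 'I_n -> R) (v : 'I_n -> V) :
  linear l -> l (\sum_i a i *: v i) = \sum_i a i *: l (v i).
Proof.
move=> ll; pose lM := GRing.isLinear.Build _ _ _ _ _ ll.
pose lL : {linear _ -> _} := HB.pack l lM.
rewrite -[l (\sum_i _)]/(lL _) linear_sum.
by apply: eq_bigr => i _; rewrite linearZ.
Qed.

(** The fields with components rho * e_i in the chart at p are global and form a
    frame where rho does not vanish; c is 1 / rho. *)
Lemma local_frame p y0 : img p y0 ->
  exists (U : set E) (c : E -> R^o) (Es : 'I_m.+1 -> M -> E),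
  [/\ open U, U y0 & U `<=` img p] /\ [/\ smooth_on U c, forall i, smooth_vf A (Es i) &
    forall X y, U y ->
      X (ci p y) = \sum_i (read A p X y 0 i * c y) *: Es i (ci p y)].
Proof.
move=> py0; have [rho cr rq] := exists_cutoff (dom_ci py0).
have srho : smooth_on (img p) (rho \o ci p) by case: cr => + _; exact.
pose U := [set y | img p y /\ (rho \o ci p) y != 0].
have Up : U `<=` img p by move=> y [].
have oU : open U.
  rewrite openE => y [py ry]; apply: filterI.
    exact: (open_nbhs_nbhs (conj (img_open p) py)).
  have := differentiable_continuous (smooth_on_diff srho py).
  move=> cont; apply: (cont [set r : R^o | r != 0]).
  exact: (open_nbhs_nbhs (conj (@open_neq R 0) ry)).
exists U, (fun y => ((rho \o ci p) y)^-1),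
  (fun i => cutoff_vf p rho (fun=> delta_mx 0 i)); split; first by split.
split.
- apply: (smooth_on_comp (@real_frame R) oU _ (smooth_on_sub Up srho)
    (@inv_smooth R)).
  by move=> y [].
- by move=> i; apply: cutoff_vf_smooth cr _; exact: smooth_on_cst (img_open p).
- move=> X y [py ry]; have pz := dom_ci py; have zz := dom_self (ci p y).
  rewrite {1}(read_inv X pz) cmK // {1}[read A p X y]row_sum_delta.
  rewrite (linear_sumZ _ _ (transport_linear pz zz)); apply: eq_bigr => i _.
  by rewrite /cutoff_vf scalerA divfK.
Qed.

(** Identities tested against global smooth vector fields therefore hold in every
    tangent space. *)
Lemma exists_smooth_vf p v : exists2 X, smooth_vf A X & X p = v.
Proof.
have [rho cr rp] := exists_cutoff (dom_self p).
exists (cutoff_vf p rho (fun=> (rho p)^-1 *: v)).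
  by apply: cutoff_vf_smooth cr _; apply: smooth_on_cst; exact: img_open.
rewrite /cutoff_vf transport_id ?scalerA ?divff ?scale1r //; exact: dom_self.
Qed.

(** Tested on rho times a coordinate function centred at p, V gives rho p times its
    coordinate at p. *)
Lemma vf_eq0 V : (forall f, smooth_fun A f -> forall p, act A V f p = 0) ->
  forall p, V p = 0.
Proof.
move=> HV p; have [rho cr rp] := exists_cutoff (dom_self p).
apply/rowP => i; rewrite mxE.
pose f (y : E) : R^o := y 0 i - cm p p 0 i.
have [ll lc _] := @row_frame R m.
have sf U : open U -> smooth_on U f.
  move=> oU; apply: smooth_on_add => //; last exact: smooth_on_cst.
  apply: (smooth_on_clin (l := fun v : E => v 0 i : R^o) (f := id)) => //.
  exact: smooth_on_id.
have sF := cutoff_smooth_fun cr (sf _ (img_open p)).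
have := HV _ sF p; rewrite /act.
have -> : 'D_(V p) ((fun z => rho z * f (cm p z)) \o ci p) (cm p p) =
    'D_(V p) (fun y => (rho \o ci p) y *: f y) (cm p p).
  apply: near_eq_derive.
  have := open_nbhs_nbhs (conj (img_open p) (img_cm (dom_self p))).
  by apply: filterS => y py /=; rewrite cmK.
have df : differentiable f (cm p p) by exact: (smooth_on_diff (sf _ openT)).
rewrite derive_scale //; last by apply: smooth_fun_diff (dom_self p); case: cr.
rewrite /= {1}/f subrr scaler0 add0r ciK; last exact: dom_self.
have -> : 'D_(V p) f (cm p p) = V p 0 i.
  rewrite (derive_add (f := fun y : E => y 0 i : R^o) (g := fun=> - cm p p 0 i)).
  - rewrite derive_cst addr0.
    have did : differentiable (@id E) (cm p p) by exact: ex_diff.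
    have [_ ->] := derive_clin (V p) (ll i) (lc i) did.
    by rewrite derive_id.
  - exact: differentiable_coord.
  - exact: differentiable_cst.
by move/eqP; rewrite mulf_eq0 (negbTE rp) /= => /eqP.
Qed.

(** * Lie brackets as commutators of derivations *)

(** The product rule for D_Y F as a combination of partial derivatives of F, with
    the coefficients of Y differentiated in the first term and frozen in the
    second. *)
Lemma derive_derive_along (U : set E) (F : E -> R^o) (Y : E -> E) a u :
  open U -> U a -> smooth_on U F -> smooth_on U Y ->
  'D_u (fun y => 'D_(Y y) F y) a = 'D_('D_u Y a) F a + 'D_u ('D_(Y a) F) a.
Proof.
move=> oU Ua sF sY; have [ll lc _] := @row_frame R m.
pose e i : E := delta_mx 0 i.
have nU : nbhs a U := open_nbhs_nbhs (conj oU Ua).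
have dF y : U y -> differentiable F y by exact: smooth_on_diff.
have FE (w : E) y : U y -> 'D_w F y = \sum_i (w 0 i : R^o) *: 'D_(e i) F y.
  by move=> /dF dFy; rewrite (derive_frame _ (@row_frame R m) dFy).
have dDF i : differentiable ('D_(e i) F) a.
  by apply: smooth_on_diff (smooth_on_derive _ sF) Ua.
have dY := smooth_on_diff sY Ua.
have dYi i := derive_clin u (ll i) (lc i) dY.
have dsum (c : 'I_m.+1 -> E -> R^o) : (forall i, differentiable (c i) a) ->
    'D_u (fun y => \sum_i (c i y) *: 'D_(e i) F y) a =
    \sum_i ('D_u (c i) a *: 'D_(e i) F a + c i a *: 'D_u ('D_(e i) F) a).
  move=> dc.
  rewrite (_ : (fun y => _) = \sum_i (fun y => c i y *: 'D_(e i) F y)); last first.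
    by apply/funext => y; rewrite fct_sumE.
  rewrite derive_sum; last first.
    by move=> i; apply/diff_derivable/differentiable_scale.
  by apply: eq_bigr => i _; rewrite derive_scale.
rewrite (near_eq_derive (g := fun y => \sum_i (Y y 0 i : R^o) *: 'D_(e i) F y));
  last by apply: filterS nU => y Uy; exact: FE.
rewrite (dsum (fun i y => Y y 0 i)); last by move=> i; case: (dYi i).
rewrite [X in _ + X](near_eq_derive
    (g := fun y => \sum_i (Y a 0 i : R^o) *: 'D_(e i) F y));
  last by apply: filterS nU => y Uy; exact: FE.
rewrite (dsum (fun i y => Y a 0 i)); last by move=> i; exact: differentiable_cst.
rewrite FE // -big_split /=; apply: eq_bigr => i _.
have [_ ->] := dYi i.
by rewrite derive_cst scale0r add0r.
Qed.

Let deriveB_dir (F : E -> R^o) a u v : differentiable F a ->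
  'D_(u - v) F a = 'D_u F a - 'D_v F a.
Proof. by move=> dF; rewrite !(deriveE _ dF) linearB. Qed.

Let subrAC_cancel (a b c : R) : a + c - (b + c) = a - b.
Proof. by ring. Qed.

(** In a chart the second-order terms of X (Y f) and Y (X f) cancel by the symmetry
    of second derivatives, and the first-order terms are the derivative of f along
    DY.X - DX.Y. *)
Lemma act_bracket X Y f : smooth_vf A X -> smooth_vf A Y -> smooth_fun A f ->
  forall p, act A (bracket A X Y) f p = act A X (act A Y f) p - act A Y (act A X f) p.
Proof.
move=> sX sY sf p.
have pp := dom_self p; pose a := cm p p; pose F := f \o ci p.
have dF : differentiable F a by exact: smooth_fun_diff.
have pa : img p a by exact: img_cm.
have nU : nbhs a (img p) := open_nbhs_nbhs (conj (img_open p) pa).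
have step Z W : smooth_vf A W -> act A Z (act A W f) p =
    'D_('D_(Z p) (read A p W) a) F a + 'D_(Z p) ('D_(W p) F) a.
  move=> sW; rewrite {1}/act (near_eq_derive (g := fun y => 'D_(read A p W y) F y)).
    rewrite (derive_derive_along _ (img_open p) pa (sf p) (sW p)).
    by rewrite read_self.
  by apply: filterS nU => y py; exact: act_ci.
rewrite (step X Y sY) (step Y X sX).
rewrite (derive_comm (Y p) (X p) (img_open p) pa (sf p)).
have -> : act A (bracket A X Y) f p =
    'D_('D_(X p) (read A p Y) a) F a - 'D_('D_(Y p) (read A p X) a) F a.
  exact: deriveB_dir.
exact: (esym (subrAC_cancel _ _ _)).
Qed.

Let jacobi_cancel (x y z a b c d e f : R) : x = a - b - (c - d) ->
  y = c - e - (f - b) -> z = f - d - (a - e) -> x + y + z = 0.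
Proof. by move=> -> -> ->; ring. Qed.

(** It is enough to let the sum act on functions, where brackets are commutators.
    Smoothness of brackets is a hypothesis because it follows at once from a
    torsion-free connection. *)
Lemma bracket_jacobi : (forall X Y, smooth_vf A X -> smooth_vf A Y ->
    smooth_vf A (bracket A X Y)) ->
  forall X Y Z, smooth_vf A X -> smooth_vf A Y -> smooth_vf A Z -> forall p,
    bracket A X (bracket A Y Z) p + bracket A Y (bracket A Z X) p
    + bracket A Z (bracket A X Y) p = 0.
Proof.
move=> sbr X Y Z sX sY sZ.
apply: (vf_eq0 (V := fun p => bracket A X (bracket A Y Z) p
   + bracket A Y (bracket A Z X) p + bracket A Z (bracket A X Y) p)).
move=> f sf p.
rewrite (act_vf_add (fun q => bracket A X (bracket A Y Z) q
  + bracket A Y (bracket A Z X) q) (bracket A Z (bracket A X Y)) p sf).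
rewrite (act_vf_add (bracket A X (bracket A Y Z)) (bracket A Y (bracket A Z X)) p sf).
have step U V W : smooth_vf A U -> smooth_vf A V -> smooth_vf A W ->
  act A (bracket A U (bracket A V W)) f p =
  act A U (act A V (act A W f)) p - act A U (act A W (act A V f)) p
  - (act A V (act A W (act A U f)) p - act A W (act A V (act A U f)) p).
  move=> sU sV sW.
  have sUf := smooth_fun_act sU sf.
  have sVf := smooth_fun_act sV sf; have sWf := smooth_fun_act sW sf.
  rewrite (act_bracket sU (sbr _ _ sV sW) sf) (act_bracket sV sW sUf).
  have -> : act A (bracket A V W) f =
      fun q => act A V (act A W f) q - act A W (act A V f) q.
    by apply/funext => q; exact: (act_bracket sV sW sf).
  by rewrite (act_sub _ _ (smooth_fun_act sV sWf) (smooth_fun_act sW sVf)).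
exact: (jacobi_cancel (step _ _ _ sX sY sZ) (step _ _ _ sY sZ sX)
  (step _ _ _ sZ sX sY)).
Qed.

End ManifoldTheory.

(** * Levi-Civita calculus on a contact pseudo-metric manifold *)

(** The calculus uses only the formal properties of smooth functions, vector fields,
    derivations, brackets and connection, so they are stated as hypotheses: sf and sv
    are the smooth functions and fields, D X f is the derivative of f along X. *)
Section ContactCalculus.
Context {R : realFieldType} {M : Type} {E : lmodType R}.
Variables (sf : (M -> R) -> Prop) (sv : (M -> E) -> Prop).
Variables (D : (M -> E) -> (M -> R) -> (M -> R)).
Variables (br nabla : (M -> E) -> (M -> E) -> (M -> E)).
Variables (phi : M -> E -> E) (xi : M -> E) (eta : M -> E -> R).
Variables (g : M -> E -> E -> R) (eps : R).

Hypothesis sf_cst : forall c, sf (fun=> c).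
Hypothesis sf_add : forall f k, sf f -> sf k -> sf (fun p => f p + k p).
Hypothesis sf_mul : forall f k, sf f -> sf k -> sf (fun p => f p * k p).
Hypothesis sf_D : forall X f, sv X -> sf f -> sf (D X f).
Hypothesis sv_lin : forall f X Y, sf f -> sv X -> sv Y ->
  sv (fun p => f p *: X p + Y p).
Hypothesis sv0 : sv (fun=> 0).
Hypothesis D_add : forall X f k p, sf f -> sf k ->
  D X (fun q => f q + k q) p = D X f p + D X k p.
Hypothesis D_mul : forall X f k p, sf f -> sf k ->
  D X (fun q => f q * k q) p = D X f p * k p + f p * D X k p.
Hypothesis D_cst : forall X c p, D X (fun=> c) p = 0.
Hypothesis D_br : forall X Y f p, sv X -> sv Y -> sf f ->
  D (br X Y) f p = D X (D Y f) p - D Y (D X f) p.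
Hypothesis jacobi : forall X Y Z p, sv X -> sv Y -> sv Z ->
  br X (br Y Z) p + br Y (br Z X) p + br Z (br X Y) p = 0.

Hypothesis gC : forall p u v, g p u v = g p v u.
Hypothesis gP : forall p a u v w, g p (a *: u + v) w = a * g p u w + g p v w.
Hypothesis g_nondeg : forall p u, (forall v, g p u v = 0) -> u = 0.
Hypothesis sv_ext : forall p u, exists2 X, sv X & X p = u.
Hypothesis sf_g : forall X Y, sv X -> sv Y -> sf (fun p => g p (X p) (Y p)).
Hypothesis sv_nabla : forall X Y, sv X -> sv Y -> sv (nabla X Y).
Hypothesis nabla_tensor : forall X X' Y f p, sv X -> sv X' -> sv Y -> sf f ->
  nabla (fun q => f q *: X q + X' q) Y p = f p *: nabla X Y p + nabla X' Y p.
Hypothesis nabla_leibniz : forall X Y Y' f p, sv X -> sv Y -> sv Y' -> sf f ->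
  nabla X (fun q => f q *: Y q + Y' q) p
  = D X f p *: Y p + f p *: nabla X Y p + nabla X Y' p.
Hypothesis nabla_torsion : forall X Y p, sv X -> sv Y ->
  nabla X Y p - nabla Y X p = br X Y p.
Hypothesis nabla_metric : forall X Y Z p, sv X -> sv Y -> sv Z ->
  D X (fun q => g q (Y q) (Z q)) p
  = g p (nabla X Y p) (Z p) + g p (Y p) (nabla X Z p).

Hypothesis phiP : forall p a u v, phi p (a *: u + v) = a *: phi p u + phi p v.
Hypothesis sv_phi : forall X, sv X -> sv (fun p => phi p (X p)).
Hypothesis sv_xi : sv xi.
Hypothesis etaP : forall p a u v, eta p (a *: u + v) = a * eta p u + eta p v.
Hypothesis sf_eta : forall X, sv X -> sf (fun p => eta p (X p)).
Hypothesis eps_sign : eps = 1 \/ eps = -1.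
Hypothesis phi2 : forall p u, phi p (phi p u) = - u + eta p u *: xi p.
Hypothesis eta_xi : forall p, eta p (xi p) = 1.
Hypothesis phi_xi : forall p, phi p (xi p) = 0.
Hypothesis eta_phi : forall p u, eta p (phi p u) = 0.
Hypothesis compat : forall p u v,
  g p (phi p u) (phi p v) = g p u v - eps * eta p u * eta p v.
Hypothesis contact : forall X Y p, sv X -> sv Y ->
  D X (fun q => eta q (Y q)) p - D Y (fun q => eta q (X q)) p - eta p (br X Y p)
  = 2 * g p (X p) (phi p (Y p)).

Lemma eps2 : eps * eps = 1.
Proof. by case: eps_sign => ->; rewrite ?mulrNN mulr1. Qed.

Lemma gDl p u v w : g p (u + v) w = g p u w + g p v w.
Proof. by have := gP p 1 u v w; rewrite scale1r mul1r. Qed.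
Lemma g0l p w : g p 0 w = 0.
Proof.
by have /eqP := gDl p 0 0 w; rewrite addr0 -subr_eq0 opprD addNKr oppr_eq0 => /eqP.
Qed.
Lemma gZl p a u w : g p (a *: u) w = a * g p u w.
Proof. by rewrite -[_ *: _]addr0 gP g0l addr0. Qed.
Lemma gNl p u w : g p (- u) w = - g p u w.
Proof. by rewrite -scaleN1r gZl mulN1r. Qed.
Lemma gDr p u v w : g p w (u + v) = g p w u + g p w v.
Proof. by rewrite !(gC p w) gDl. Qed.
Lemma g0r p w : g p w 0 = 0. Proof. by rewrite gC g0l. Qed.
Lemma gZr p a u w : g p w (a *: u) = a * g p w u.
Proof. by rewrite !(gC p w) gZl. Qed.
Lemma gNr p u w : g p w (- u) = - g p w u.
Proof. by rewrite !(gC p w) gNl. Qed.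
Let gE := (gDl, g0l, gZl, gNl, gDr, g0r, gZr, gNr).

Lemma phiD p u v : phi p (u + v) = phi p u + phi p v.
Proof. by have := phiP p 1 u v; rewrite !scale1r. Qed.
Lemma phi0 p : phi p 0 = 0.
Proof. by have := phiP p (-1) 0 0; rewrite !scaleN1r oppr0 addr0 addNr. Qed.
Lemma phiZ p a u : phi p (a *: u) = a *: phi p u.
Proof. by rewrite -[_ *: _]addr0 phiP phi0 addr0. Qed.
Lemma phiN p u : phi p (- u) = - phi p u.
Proof. by rewrite -scaleN1r phiZ scaleN1r. Qed.
Let phiE := (phiD, phi0, phiZ, phiN).

(** Compatibility of g with phi, with the second vector equal to xi. *)
Lemma g_xi p u : g p u (xi p) = eps * eta p u.
Proof.
have := compat p u (xi p); rewrite phi_xi g0r eta_xi mulr1 => H; lra.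
Qed.

Lemma eta_g p u : eta p u = eps * g p u (xi p).
Proof. by rewrite g_xi mulrA eps2 mul1r. Qed.

(** Compatibility of g with phi, applied to phi v. *)
Lemma g_phi p u v : g p (phi p u) v = - g p u (phi p v).
Proof.
have := compat p u (phi p v); rewrite eta_phi mulr0 subr0 phi2 !gE g_xi eta_phi.
by rewrite !mulr0 addr0 => <-; rewrite opprK.
Qed.

Lemma g_ext p u v : (forall w, g p u w = g p v w) -> u = v.
Proof.
move=> H; apply/eqP; rewrite -subr_eq0; apply/eqP; apply: (g_nondeg (p := p)) => w.
by rewrite !gE H subrr.
Qed.

Lemma g_ext_vf (V W : M -> E) :
  (forall Y p, sv Y -> g p (V p) (Y p) = g p (W p) (Y p)) -> forall p, V p = W p.
Proof.
move=> H p; apply: (g_ext (p := p)) => w.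
by have [Y sY <-] := sv_ext p w; exact: H.
Qed.

Lemma svZ c X : sv X -> sv (fun p => c *: X p).
Proof.
move=> sX; rewrite (_ : (fun p => _) = fun p => c *: X p + 0); last first.
  by apply/funext => p; rewrite addr0.
exact: (sv_lin (sf_cst c) sX sv0).
Qed.

Lemma svD X Y : sv X -> sv Y -> sv (fun p => X p + Y p).
Proof.
move=> sX sY; rewrite (_ : (fun p => _) = fun p => 1 *: X p + Y p); last first.
  by apply/funext => p; rewrite scale1r.
exact: (sv_lin (sf_cst 1) sX sY).
Qed.

Lemma nabla0 X p : sv X -> nabla X (fun=> 0) p = 0.
Proof.
move=> sX; have := nabla_leibniz p sX sv0 sv0 (sf_cst (-1)).
rewrite /= (_ : (fun q : M => -1 *: (0 : E) + 0) = fun=> 0); last first.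
  by apply/funext => q /=; rewrite scaler0 addr0.
by rewrite D_cst scale0r add0r scaleN1r addNr.
Qed.

Lemma nabla0l X p : sv X -> nabla (fun=> 0) X p = 0.
Proof.
move=> sX; have := nabla_tensor p sv0 sv0 sX (sf_cst (-1)).
rewrite /= (_ : (fun q : M => -1 *: (0 : E) + 0) = fun=> 0); last first.
  by apply/funext => q /=; rewrite scaler0 addr0.
by rewrite scaleN1r addNr.
Qed.

Lemma nabla_lin c X Y Z p : sv X -> sv Y -> sv Z ->
  nabla X (fun q => c *: Y q + Z q) p = c *: nabla X Y p + nabla X Z p.
Proof.
by move=> sX sY sZ; rewrite (nabla_leibniz p sX sY sZ (sf_cst c)) D_cst scale0r add0r.
Qed.

Lemma nablaZ c X Y p : sv X -> sv Y ->
  nabla X (fun q => c *: Y q) p = c *: nabla X Y p.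
Proof.
move=> sX sY; have := nabla_lin c p sX sY sv0; rewrite nabla0 // addr0 => <-.
by congr (nabla _ _ _); apply/funext => q; rewrite addr0.
Qed.

Lemma nablaZl f X Y p : sv X -> sv Y -> sf f ->
  nabla (fun q => f q *: X q) Y p = f p *: nabla X Y p.
Proof.
move=> sX sY sff; have := nabla_tensor p sX sv0 sY sff; rewrite nabla0l // addr0 => <-.
by congr (nabla _ _ _); apply/funext => q; rewrite addr0.
Qed.

Lemma sv_br X Y : sv X -> sv Y -> sv (br X Y).
Proof.
move=> sX sY; rewrite (_ : br X Y = fun p => -1 *: nabla Y X p + nabla X Y p).
  by apply: sv_lin; [exact: sf_cst | exact: sv_nabla | exact: sv_nabla].
by apply/funext => p; rewrite -nabla_torsion // scaleN1r addrC.
Qed.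

Lemma D_cstM X c f p : sf f -> D X (fun q => c * f q) p = c * D X f p.
Proof. by move=> sff; rewrite D_mul // D_cst mul0r add0r. Qed.

Fact lock_key : unit. Proof. exact: tt. Qed.
(** S X is the self-adjoint part of the covariant derivative of xi; it vanishes
    exactly when xi is a Killing field. The definition is locked, as is that of T,
    so that the additivity rules for g, phi and eta do not see the sum. *)
Definition S X p : E := locked_with lock_key (nabla X xi p + eps *: phi p (X p)).
Definition T X Y p : E :=
  locked_with lock_key (nabla X (fun q => phi q (Y q)) p - phi p (nabla X Y p)).

Lemma SE X p : S X p = nabla X xi p + eps *: phi p (X p).
Proof. by rewrite /S unlock. Qed.
Lemma TE X Y p :
  T X Y p = nabla X (fun q => phi q (Y q)) p - phi p (nabla X Y p).
Proof. by rewrite /T unlock. Qed.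

Lemma nabla_xiE X p : nabla X xi p = S X p - eps *: phi p (X p).
Proof. by rewrite SE addrK. Qed.

Lemma nabla_phiE X Y p :
  nabla X (fun q => phi q (Y q)) p = T X Y p + phi p (nabla X Y p).
Proof. by rewrite TE subrK. Qed.

Lemma D_eta X Y p : sv X -> sv Y -> D X (fun q => eta q (Y q)) p =
  eta p (nabla X Y p) + eps * g p (Y p) (nabla X xi p).
Proof.
move=> sX sY; rewrite (_ : (fun q => _) = fun q => eps * g q (Y q) (xi q)).
  rewrite D_cstM; last exact: (sf_g sY sv_xi).
  by rewrite (nabla_metric p sX sY sv_xi) mulrDr -eta_g.
by apply/funext => q; rewrite eta_g.
Qed.

Lemma g_nabla_xi_xi X p : sv X -> g p (nabla X xi p) (xi p) = 0.
Proof.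
move=> sX; have := nabla_metric p sX sv_xi sv_xi.
rewrite (_ : (fun q => _) = fun=> eps); last first.
  by apply/funext => q; rewrite g_xi eta_xi mulr1.
by rewrite D_cst [X in _ + X]gC => H; lra.
Qed.

(** The contact condition in terms of the connection: the skew part of the covariant
    derivative of xi is - eps phi. *)
Lemma contact_nabla X Y p : sv X -> sv Y -> 2 * g p (X p) (phi p (Y p)) =
  eps * g p (Y p) (nabla X xi p) - eps * g p (X p) (nabla Y xi p).
Proof.
move=> sX sY; rewrite -(contact p sX sY) -(nabla_torsion p sX sY).
rewrite (D_eta p sX sY) (D_eta p sY sX).
rewrite -[nabla X Y p - _]addrC -scaleN1r etaP; ring.
Qed.

(** The contact condition with Y = xi, where the other term vanishes because g(xi,
    xi) is constant. *)
Lemma nabla_xi_xi p : nabla xi xi p = 0.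
Proof.
apply: (g_ext_vf (V := nabla xi xi) (W := fun=> 0)) => Y q sY.
have := contact_nabla q sY sv_xi; rewrite phi_xi g0r mulr0 gC g_nabla_xi_xi //.
by rewrite g0l gC; case: eps_sign => -> H; lra.
Qed.

(** Adding eps phi cancels the skew part of the covariant derivative of xi. *)
Lemma S_sym X Y p : sv X -> sv Y -> g p (S X p) (Y p) = g p (X p) (S Y p).
Proof.
move=> sX sY; have := contact_nabla p sX sY.
rewrite !SE !gE g_phi (gC p (Y p)); case: eps_sign => -> H; lra.
Qed.

Lemma sv_S X : sv X -> sv (S X).
Proof.
move=> sX; rewrite (_ : S X = fun p => nabla X xi p + eps *: phi p (X p)).
  by apply: svD; [exact: sv_nabla | exact/svZ/sv_phi].
by apply/funext => p; exact: SE.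
Qed.

Lemma S_xi p : S xi p = 0.
Proof. by rewrite SE nabla_xi_xi phi_xi scaler0 addr0. Qed.

Lemma eta_S X p : sv X -> eta p (S X p) = 0.
Proof.
by move=> sX; rewrite eta_g SE !gE g_nabla_xi_xi // g_phi phi_xi g0r; ring.
Qed.

Lemma S_tensor f X Y p : sf f -> sv X -> sv Y ->
  S (fun q => f q *: X q + Y q) p = f p *: S X p + S Y p.
Proof.
move=> sff sX sY; rewrite !SE (nabla_tensor p sX sY sv_xi sff) phiP.
by apply: (g_ext (p := p)) => w; rewrite !gE; ring.
Qed.

Lemma S_eq X Y : (forall p, X p = Y p) -> forall p, S X p = S Y p.
Proof. by move=> XY p; congr (S _ p); apply/funext. Qed.

(** The covariant derivative of phi is skew because phi is. *)
Lemma T_skew X Y Z p : sv X -> sv Y -> sv Z ->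
  g p (T X Y p) (Z p) = - g p (T X Z p) (Y p).
Proof.
move=> sX sY sZ.
have := nabla_metric p sX (sv_phi sY) sZ; have := nabla_metric p sX sY (sv_phi sZ).
rewrite (_ : (fun q => g q (phi q (Y q)) _) =
  fun q => -1 * g q (Y q) (phi q (Z q))); last first.
  by apply/funext => q; rewrite g_phi mulN1r.
rewrite D_cstM; last exact: (sf_g sY (sv_phi sZ)).
move=> ->; rewrite !nabla_phiE !gE !g_phi (gC p (Y p) (T X Z p)).
rewrite (gC p (Y p) (phi p _)) g_phi; lra.
Qed.

Lemma D_sub X f k p : sf f -> sf k ->
  D X (fun q => f q - k q) p = D X f p - D X k p.
Proof.
move=> sff sfk; rewrite (_ : (fun q => _) = fun q => f q + -1 * k q).
  rewrite D_add // ?D_cstM ?mulN1r //.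
  exact: (sf_mul (sf_cst (-1)) sfk).
by apply/funext => q; rewrite mulN1r.
Qed.

Lemma sf_sub f k : sf f -> sf k -> sf (fun q => f q - k q).
Proof.
move=> sff sfk; rewrite (_ : (fun q => _) = fun q => f q + -1 * k q).
  exact: (sf_add sff (sf_mul (sf_cst (-1)) sfk)).
by apply/funext => q; rewrite mulN1r.
Qed.

(** The form g(X, phi Y) is closed, being d eta; this is the identity d (d eta) = 0,
    by the Jacobi identity and the commutator rule, written with a torsion-free
    connection. *)
Lemma T_cyclic X Y Z p : sv X -> sv Y -> sv Z ->
  g p (T X Y p) (Z p) + g p (T Y Z p) (X p) + g p (T Z X p) (Y p) = 0.
Proof.
move=> sX sY sZ.
have E1 U V W : sv U -> sv V -> sv W ->
    D U (D V (fun q => eta q (W q))) p - D U (D W (fun q => eta q (V q))) p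
    - D U (fun q => eta q (br V W q)) p
    = 2 * (g p (nabla U V p) (phi p (W p)) + g p (T U W p) (V p)
           - g p (phi p (V p)) (nabla U W p)).
  move=> sU sV sW.
  have sVW := sf_D sV (sf_eta sW); have sWV := sf_D sW (sf_eta sV).
  have sb := sf_eta (sv_br sV sW).
  rewrite -(D_sub U p sVW sWV) -(D_sub U p (sf_sub sVW sWV) sb).
  rewrite (_ : (fun q => _) = fun q => 2 * g q (V q) (phi q (W q))); last first.
    by apply/funext => q; rewrite -(contact q sV sW).
  rewrite D_cstM; last exact: (sf_g sV (sv_phi sW)).
  rewrite (nabla_metric p sU sV (sv_phi sW)) nabla_phiE gDr (gC p (V p) (T U W p)).
  by rewrite g_phi opprK addrA.
have E2 U V W : sv U -> sv V -> sv W ->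
    D W (fun q => eta q (br U V q)) p - (D U (D V (fun q => eta q (W q))) p
      - D V (D U (fun q => eta q (W q))) p) - eta p (br W (br U V) p)
    = - 2 * (g p (phi p (W p)) (nabla U V p) - g p (phi p (W p)) (nabla V U p)).
  move=> sU sV sW; have sb := sv_br sU sV.
  rewrite -(D_br p sU sV (sf_eta sW)) (contact p sW sb) -(nabla_torsion p sU sV).
  by rewrite -(opprK (g p (W p) _)) -g_phi gDr gNr; ring.
have J : eta p (br X (br Y Z) p) + eta p (br Y (br Z X) p)
    + eta p (br Z (br X Y) p) = 0.
  have := jacobi p sX sY sZ => /(congr1 (eta p)).
  have etaD u v : eta p (u + v) = eta p u + eta p v.
    by have := etaP p 1 u v; rewrite scale1r mul1r.
  have := etaP p (-1) 0 0; rewrite scaler0 addr0 mulN1r addNr => e0.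
  by rewrite !etaD e0.
have := E1 X Y Z sX sY sZ; have := E1 Y Z X sY sZ sX; have := E1 Z X Y sZ sX sY.
have := E2 X Y Z sX sY sZ; have := E2 Y Z X sY sZ sX; have := E2 Z X Y sZ sX sY.
rewrite (gC p (nabla X Y p)) (gC p (nabla Y Z p)) (gC p (nabla Z X p)).
have := T_skew p sX sZ sY; have := T_skew p sY sX sZ; have := T_skew p sZ sY sX.
move: J; lra.
Qed.

(** The covariant derivative of the identity phi^2 = - 1 + eta xi. *)
Lemma T_phi X Y p : sv X -> sv Y -> T X (fun q => phi q (Y q)) p + phi p (T X Y p)
  = (eps * g p (Y p) (nabla X xi p)) *: xi p + eta p (Y p) *: nabla X xi p.
Proof.
move=> sX sY; rewrite !TE phiD phiN phi2.
rewrite (_ : (fun q => phi q (phi q (Y q))) =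
    fun q => eta q (Y q) *: xi q + -1 *: Y q); last first.
  by apply/funext => q; rewrite phi2 scaleN1r addrC.
rewrite (nabla_leibniz p sX sv_xi (svZ (-1) sY) (sf_eta sY)) (nablaZ _ p sX sY).
by rewrite (D_eta p sX sY); apply: (g_ext (p := p)) => w; rewrite !gE; ring.
Qed.

Lemma T_xi X p : sv X -> T X xi p = - phi p (nabla X xi p).
Proof.
move=> sX; rewrite TE (_ : (fun q => _) = fun=> 0); last first.
  by apply/funext => q; rewrite phi_xi.
by rewrite nabla0 // sub0r.
Qed.

(** The cyclic identity with first argument xi, where T Y xi and T Z xi are known
    because phi xi = 0. *)
Lemma T_of_xi Y p : sv Y ->
  T xi Y p = - (phi p (S Y p) + S (fun q => phi q (Y q)) p).
Proof.
move: Y p; suff H Y : sv Y -> forall p,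
    T xi Y p = - (phi p (S Y p) + S (fun q => phi q (Y q)) p).
  by move=> Y p sY; exact: H.
move=> sY; apply: g_ext_vf => Z p sZ.
have := T_cyclic p sv_xi sY sZ; rewrite (T_skew p sY sZ sv_xi) !T_xi //.
rewrite !nabla_xiE !phiE !phi2 !gE !g_phi (S_sym p (sv_phi sY) sZ).
rewrite (gC p (phi p (Y p))) (gC p (Z p) (Y p)) !(gC p (xi p)) !g_xi; lra.
Qed.

Lemma SZ c X p : sv X -> S (fun q => c *: X q) p = c *: S X p.
Proof.
move=> sX; rewrite !SE (nablaZl p sX sv_xi (sf_cst c)) phiZ.
by apply: (g_ext (p := p)) => w; rewrite !gE; ring.
Qed.

(** Let P be the covariant derivative of phi along xi. Then P = - (phi S + S phi) by
    T_of_xi, and P anticommutes with phi by T_phi, since xi is geodesic. Together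
    they give S = phi S phi, and applying phi gives the claim. *)
Lemma S_phi X p : sv X -> S (fun q => phi q (X q)) p = - phi p (S X p).
Proof.
move=> sX; have sPX := sv_phi sX.
have := T_phi p sv_xi sX; rewrite nabla_xi_xi gE mulr0 scaler0 scale0r addr0.
rewrite (T_of_xi p sX) (T_of_xi p sPX).
rewrite (_ : (fun q => phi q (phi q (X q))) =
    fun q => eta q (X q) *: xi q + -1 *: X q); last first.
  by apply/funext => q; rewrite phi2 scaleN1r addrC.
rewrite (S_tensor p (sf_eta sX) sv_xi (svZ (-1) sX)) (SZ _ p sX) S_xi.
rewrite scaler0 add0r phiN phiD phi2 eta_S // scale0r addr0.
move=> H.
have ES : S X p = phi p (S (fun q => phi q (X q)) p).
  apply: (g_ext (p := p)) => w.
  by have /(congr1 (g p ^~ w)) := H; rewrite /= !gE; lra.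
rewrite [in RHS]ES phi2 eta_g (S_sym p sPX sv_xi) S_xi g0r mulr0 scale0r addr0.
by rewrite opprK.
Qed.

Lemma T_of_xi0 X p : sv X -> T xi X p = 0.
Proof. by move=> sX; rewrite T_of_xi // S_phi // subrr oppr0. Qed.

Lemma nabla_of_xi_phi X p : sv X ->
  nabla xi (fun q => phi q (X q)) p = phi p (nabla xi X p).
Proof. by move=> sX; rewrite nabla_phiE T_of_xi0 // add0r. Qed.

(** In terms of the connection, and since T xi = 0, the left-hand side is half the
    commutator of phi and S, which anticommute. *)
Lemma h_eq X p : sv X ->
  2^-1 *: (br xi (fun q => phi q (X q)) p - phi p (br xi X p)) = phi p (S X p).
Proof.
move=> sX; have sPX := sv_phi sX.
rewrite -(nabla_torsion p sv_xi sPX) -(nabla_torsion p sv_xi sX).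
rewrite nabla_of_xi_phi // !nabla_xiE S_phi // !phiE.
by apply: (g_ext (p := p)) => w; rewrite !gE; lra.
Qed.

Let h X p := phi p (S X p).

Lemma sv_h X : sv X -> sv (h X). Proof. by move=> sX; exact/sv_phi/sv_S. Qed.

Lemma h_sym X Y p : sv X -> sv Y -> g p (h X p) (Y p) = g p (X p) (h Y p).
Proof.
move=> sX sY; rewrite /h g_phi (S_sym p sX (sv_phi sY)) S_phi // gNr opprK //.
Qed.

Lemma h_h X p : sv X -> h (h X) p = S (S X) p.
Proof.
move=> sX; rewrite /h (S_phi p (sv_S sX)) phiN phi2 eta_S ?scale0r ?addr0 ?opprK //.
exact: sv_S.
Qed.

Let Dh X p := nabla xi (h X) p - h (nabla xi X) p.

Lemma Dh_sym X Y p : sv X -> sv Y -> g p (Dh X p) (Y p) = g p (X p) (Dh Y p).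
Proof.
move=> sX sY; have sX' := sv_nabla sv_xi sX; have sY' := sv_nabla sv_xi sY.
have := nabla_metric p sv_xi (sv_h sX) sY.
rewrite (_ : (fun q => _) = fun q => g q (X q) (h Y q)); last first.
  by apply/funext => q; exact: h_sym.
rewrite (nabla_metric p sv_xi sX (sv_h sY)) /Dh !gE (h_sym p sX' sY).
rewrite -(h_sym p sX sY') => H; lra.
Qed.

(** The Codazzi equation for X and xi computes the covariant derivative of h along
    xi as eps S - phi S^2. The first two are self-adjoint and phi S^2 is skew, so
    phi S^2 = 0, and S^2 = 0 since S takes values in the kernel of eta. *)
Lemma codazzi_xi : (forall X Y p, sv X -> sv Y ->
    nabla X (h Y) p - h (nabla X Y) p = nabla Y (h X) p - h (nabla Y X) p) ->
  forall X p, sv X -> S (S X) p = 0 /\ Dh X p = eps *: S X p.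
Proof.
move=> cod.
have DE X p : sv X -> Dh X p = eps *: S X p - phi p (S (S X) p).
  move=> sX; rewrite /Dh -(cod X xi p sX sv_xi).
  rewrite (_ : h xi = fun=> 0); last first.
    by apply/funext => q; rewrite /h S_xi phi0.
  rewrite nabla0 // sub0r /h.
  rewrite (@S_eq (nabla X xi) (fun q => - eps *: phi q (X q) + S X q)); last first.
    by move=> q; rewrite nabla_xiE scaleNr addrC.
  rewrite (S_tensor p (sf_cst (- eps)) (sv_phi sX) (sv_S sX)) S_phi //.
  rewrite !phiE phi2 eta_S // scale0r addr0.
  by apply: (g_ext (p := p)) => w; rewrite !gE; lra.
have phiSS X : sv X -> forall p, phi p (S (S X) p) = 0.
  move=> sX; apply: g_ext_vf => Y p sY; rewrite g0l.
  have := Dh_sym p sX sY; rewrite !DE // !gE (S_sym p sX sY).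
  rewrite g_phi (S_sym p (sv_S sX) (sv_phi sY)) (S_sym p sX (sv_S (sv_phi sY))).
  rewrite (@S_eq (S (fun q => phi q (Y q))) (fun q => -1 *: phi q (S Y q))); last first.
    by move=> q; rewrite S_phi // scaleN1r.
  rewrite (SZ _ p (sv_phi (sv_S sY))) (S_phi p (sv_S sY)) !gE; lra.
move=> X p sX; split; last by rewrite DE // phiSS // subr0.
rewrite -[LHS]opprK; apply/eqP; rewrite oppr_eq0; apply/eqP.
have := phi2 p (S (S X) p); rewrite phiSS // phi0 eta_S; last exact: sv_S.
by rewrite scale0r addr0.
Qed.

Let curv X Y Z p := nabla X (nabla Y Z) p - nabla Y (nabla X Z) p - nabla (br X Y) Z p.

(** With S^2 = 0 the curvature R(X, xi) xi is - W + X - eta(X) xi, where W is the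
    covariant derivative of S along xi. So W = 0, and eps S X = phi W = 0. *)
Lemma K_contact :
  (forall X p, sv X -> S (S X) p = 0 /\ Dh X p = eps *: S X p) ->
  (forall X Y p, sv X -> sv Y ->
     curv X Y xi p = eta p (Y p) *: X p - eta p (X p) *: Y p) ->
  forall X p, sv X -> S X p = 0.
Proof.
move=> cod HR X p sX; have [SS Dh1] := cod X p sX.
have sB := sv_nabla sX sv_xi; have sX' := sv_nabla sv_xi sX.
pose W : E := nabla xi (S X) p - S (nabla xi X) p.
have BE Y q : nabla Y xi q = S Y q + - eps *: phi q (Y q).
  by rewrite nabla_xiE scaleNr.
have DW : Dh X p = phi p W.
  by rewrite /Dh /h (nabla_of_xi_phi p (sv_S sX)) /W !phiE.
have E1 : nabla xi (nabla X xi) p = nabla xi (S X) p - eps *: phi p (nabla xi X p).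
  rewrite (_ : nabla X xi = fun q => - eps *: phi q (X q) + S X q); last first.
    by apply/funext => q; rewrite BE addrC.
  rewrite (nabla_lin _ p sv_xi (sv_phi sX) (sv_S sX)) nabla_of_xi_phi //.
  by rewrite scaleNr addrC.
have E2 : nabla (nabla X xi) xi p = - X p + eta p (X p) *: xi p.
  rewrite BE (@S_eq (nabla X xi) (fun q => - eps *: phi q (X q) + S X q)); last first.
    by move=> q; rewrite BE addrC.
  rewrite (S_tensor p (sf_cst (- eps)) (sv_phi sX) (sv_S sX)) S_phi // SS.
  rewrite BE !phiE phi2.
  apply: (g_ext (p := p)) => w; rewrite !gE; case: eps_sign => ->; lra.
have := HR X xi p sX sv_xi; rewrite /curv eta_xi scale1r.
rewrite (_ : nabla xi xi = fun=> 0); last by apply/funext => q; exact: nabla_xi_xi.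
rewrite nabla0 // sub0r E1.
rewrite (_ : br X xi = fun q => -1 *: nabla xi X q + nabla X xi q); last first.
  by apply/funext => q; rewrite -nabla_torsion // scaleN1r addrC.
rewrite (nabla_tensor p sX' sB sv_xi (sf_cst (-1))) E2 (BE (nabla xi X)) => H.
have W0 : W = 0.
  apply: (g_ext (p := p)) => w.
  by have /(congr1 (g p ^~ w)) := H; rewrite /W /= !gE; lra.
move: Dh1; rewrite DW W0 phi0 => /(congr1 (fun u => eps *: u)).
by rewrite scalerA eps2 scale1r scaler0.
Qed.

Section KContact.
Hypothesis S0 : forall X p, sv X -> S X p = 0.

Lemma KC_nabla_xi X p : sv X -> nabla X xi p = - eps *: phi p (X p).
Proof. by move=> sX; rewrite nabla_xiE S0 // sub0r scaleNr. Qed.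

Lemma curv_T X Y p : sv X -> sv Y -> curv X Y xi p = - eps *: (T X Y p - T Y X p).
Proof.
move=> sX sY; have sb := sv_br sX sY.
have NE U V : sv U -> sv V -> nabla U (nabla V xi) p
    = - eps *: (T U V p + phi p (nabla U V p)).
  move=> sU sV.
  rewrite (_ : nabla V xi = fun q => - eps *: phi q (V q)); last first.
    by apply/funext => q; exact: KC_nabla_xi.
  by rewrite (nablaZ _ p sU (sv_phi sV)) nabla_phiE.
rewrite /curv !NE // KC_nabla_xi // -(nabla_torsion p sX sY) !phiE.
by apply: (g_ext (p := p)) => w; rewrite !gE; ring.
Qed.

(** The equation that characterises Sasakian structures among contact pseudo-metric
    structures. *)
Definition sasakian_eq := forall X Y p, sv X -> sv Y ->
  T X Y p = g p (X p) (Y p) *: xi p - (eps * eta p (Y p)) *: X p.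

Lemma sasakian_curv : sasakian_eq -> forall X Y p, sv X -> sv Y ->
  curv X Y xi p = eta p (Y p) *: X p - eta p (X p) *: Y p.
Proof.
move=> HT X Y p sX sY; rewrite curv_T // !HT //.
apply: (g_ext (p := p)) => w; rewrite !gE (gC p (Y p) (X p)).
by case: eps_sign => ->; ring.
Qed.

(** The curvature condition prescribes T Y Z - T Z Y, and the cyclic identity turns
    this difference, tested against X, into g (T X Y) Z. *)
Lemma curv_sasakian : (forall X Y p, sv X -> sv Y ->
    curv X Y xi p = eta p (Y p) *: X p - eta p (X p) *: Y p) -> sasakian_eq.
Proof.
move=> HR X Y p sX sY; move: p.
apply: g_ext_vf => Z p sZ; rewrite !gE (gC p (xi p)) g_xi.
have := T_cyclic p sX sY sZ.
have := HR Y Z p sY sZ; rewrite curv_T // => /(congr1 (g p ^~ (X p))).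
rewrite /= !gE (T_skew p sZ sX sY).
rewrite (gC p (Y p) (X p)) (gC p (Z p) (X p)).
by case: eps_sign => ->; lra.
Qed.

End KContact.

Section Normal.
Hypothesis normal : forall X Y p, sv X -> sv Y ->
  T (fun q => phi q (X q)) Y p - phi p (T X Y p)
  + (eps * g p (Y p) (nabla X xi p)) *: xi p
  = T (fun q => phi q (Y q)) X p - phi p (T Y X p)
  + (eps * g p (X p) (nabla Y xi p)) *: xi p.

(** For Y = xi the two sides differ by 2 S X. *)
Lemma normal_S0 X p : sv X -> S X p = 0.
Proof.
move=> sX; have sPX := sv_phi sX.
have := normal p sX sv_xi; rewrite T_of_xi0 // !T_xi // nabla_xi_xi.
rewrite (_ : (fun q => phi q (xi q)) = fun=> 0); last first.
  by apply/funext => q; exact: phi_xi.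
have -> : T (fun=> 0) X p = 0.
  by rewrite TE !nabla0l ?phi0 ?subr0 //; exact: sv_phi.
rewrite phi0 subr0 add0r gE mulr0 scale0r gC g_nabla_xi_xi // mulr0 scale0r addr0.
rewrite !nabla_xiE S_phi // !phiE !phi2 eta_S // eta_phi !scale0r addr0 => H.
apply: (g_ext (p := p)) => w; rewrite g0l.
by have /(congr1 (g p ^~ w)) := H; rewrite /= !gE; lra.
Qed.

Lemma T_tensor f X X' Y p : sf f -> sv X -> sv X' -> sv Y ->
  T (fun q => f q *: X q + X' q) Y p = f p *: T X Y p + T X' Y p.
Proof.
move=> sff sX sX' sY; rewrite !TE (nabla_tensor p sX sX' (sv_phi sY) sff).
rewrite (nabla_tensor p sX sX' sY sff) phiP.
by apply: (g_ext (p := p)) => w; rewrite !gE; ring.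
Qed.

(** By the cyclic identity the terms phi (T X Y) - phi (T Y X), tested against Z,
    are g (T (phi Z) X) Y. *)
Lemma normal_cyclic X Y Z p : sv X -> sv Y -> sv Z ->
  g p (T (fun q => phi q (X q)) Y p) (Z p) - g p (T (fun q => phi q (Y q)) X p) (Z p)
  - g p (T (fun q => phi q (Z q)) X p) (Y p)
  = - 2 * eps * g p (X p) (phi p (Y p)) * eta p (Z p).
Proof.
move=> sX sY sZ; have := normal p sX sY => /(congr1 (g p ^~ (Z p))) /=.
rewrite !(KC_nabla_xi normal_S0) // !gE !g_phi (gC p (xi p)) g_xi.
have := T_cyclic p sX sY (sv_phi sZ); rewrite (T_skew p sY (sv_phi sZ) sX).
rewrite (gC p (Y p) (phi p (X p))) g_phi.
by case: eps_sign => ->; lra.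
Qed.

(** Adding two cyclic permutations of normal_cyclic isolates T (phi X) Y. This is
    enough because X = - phi (phi X) + eta(X) xi and T xi = 0. *)
Lemma normal_sasakian : sasakian_eq.
Proof.
have onphi X Y p : sv X -> sv Y -> T (fun q => phi q (X q)) Y p =
    g p (phi p (X p)) (Y p) *: xi p - (eps * eta p (Y p)) *: phi p (X p).
  move=> sX sY; move: p; apply: g_ext_vf => Z p sZ.
  rewrite !gE (gC p (xi p)) g_xi.
  have := normal_cyclic p sZ sX sY; have := normal_cyclic p sX sY sZ.
  rewrite (T_skew p (sv_phi sX) sZ sY) (T_skew p (sv_phi sY) sZ sX).
  rewrite !g_phi (gC p (Z p)) g_phi.
  by case: eps_sign => ->; lra.
move=> X Y p sX sY; have sPPX := sv_phi (sv_phi sX).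
have -> : T X Y p = T (fun q => eta q (X q) *: xi q + -1 *: phi q (phi q (X q))) Y p.
  congr (T _ _ _); apply/funext => q; rewrite phi2 scaleN1r opprD opprK addrCA.
  by rewrite addrN addr0.
rewrite (T_tensor p (sf_eta sX) sv_xi (svZ (-1) sPPX) sY) T_of_xi0 // scaler0 add0r.
rewrite (_ : (fun q => -1 *: phi q (phi q (X q))) =
    fun q => -1 *: phi q (phi q (X q)) + 0); last first.
  by apply/funext => q; rewrite addr0.
rewrite (T_tensor p (sf_cst (-1)) sPPX sv0 sY).
have -> : T (fun=> 0) Y p = 0.
  by rewrite TE !nabla0l ?phi0 ?subr0 //; exact: sv_phi.
rewrite (onphi _ _ p (sv_phi sX) sY) phi2.
apply: (g_ext (p := p)) => w; rewrite !gE !(gC p (xi p)) !g_xi.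
by case: eps_sign => ->; lra.
Qed.

End Normal.

(** * The Nijenhuis torsion in terms of the connection *)

(** The first component of J (X, f d/dt). *)
Definition J1 (X : M -> E) (f : M -> R) q := phi q (X q) - f q *: xi q.

(** The components nij1 and nij2 of the Nijenhuis torsion of J on (X, f d/dt) and
    (Y, k d/dt), with J^2 = - 1 taken into account. Here X, Y, f and k live on M:
    derivatives along d/dt cancel in the torsion. *)
Definition nij1 X f Y k p :=
  - br X Y p + br (J1 X f) (J1 Y k) p
  - (phi p (br (J1 X f) Y p)
     - (D (J1 X f) k p - D Y (fun q => eta q (X q)) p) *: xi p)
  - (phi p (br X (J1 Y k) p)
     - (D X (fun q => eta q (Y q)) p - D (J1 Y k) f p) *: xi p).

Definition nij2 X f Y k p :=
  - (D X k p - D Y f p)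
  + (D (J1 X f) (fun q => eta q (Y q)) p - D (J1 Y k) (fun q => eta q (X q)) p)
  - eta p (br (J1 X f) Y p) - eta p (br X (J1 Y k) p).

Lemma etaD p u v : eta p (u + v) = eta p u + eta p v.
Proof. by have := etaP p 1 u v; rewrite scale1r mul1r. Qed.
Lemma eta0 p : eta p 0 = 0.
Proof. by have := etaP p (-1) 0 0; rewrite scaler0 addr0 mulN1r addNr. Qed.
Lemma etaZ p a u : eta p (a *: u) = a * eta p u.
Proof. by rewrite -[_ *: _]addr0 etaP eta0 addr0. Qed.
Lemma etaN p u : eta p (- u) = - eta p u.
Proof. by rewrite -scaleN1r etaZ mulN1r. Qed.
Let etaE := (etaD, eta0, etaZ, etaN).

Lemma sv_J1 X f : sv X -> sf f -> sv (J1 X f).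
Proof.
move=> sX sff; rewrite (_ : J1 X f = fun q => (-1 * f q) *: xi q + phi q (X q)).
  by apply: sv_lin (sv_phi sX) => //; exact: (sf_mul (sf_cst (-1)) sff).
by apply/funext => q; rewrite /J1 mulN1r scaleNr addrC.
Qed.

(** The first component of the covariant derivative of J for the product
    connection. *)
Let K1 X Y (k : M -> R) p := T X Y p - k p *: nabla X xi p.

Lemma nabla_J1 X Y k p : sv X -> sv Y -> sf k ->
  nabla X (J1 Y k) p = phi p (nabla X Y p) - D X k p *: xi p + K1 X Y k p.
Proof.
move=> sX sY sfk.
rewrite (_ : J1 Y k = fun q => (-1 * k q) *: xi q + phi q (Y q)); last first.
  by apply/funext => q; rewrite /J1 mulN1r scaleNr addrC.
rewrite (nabla_leibniz p sX sv_xi (sv_phi sY) (sf_mul (sf_cst (-1)) sfk)).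
rewrite (D_cstM _ _ p sfk) nabla_phiE /K1.
by apply: (g_ext (p := p)) => w; rewrite !gE; ring.
Qed.

Section Nijenhuis.
Variables (X Y : M -> E) (f k : M -> R).
Hypotheses (sX : sv X) (sY : sv Y) (sff : sf f) (sfk : sf k).

(** The torsion is the antisymmetrisation of the tensor (D_(J Z) J) W - J (D_Z J) W,
    D being the product connection, which is torsion-free. *)
Lemma nij1E p : nij1 X f Y k p =
  K1 (J1 X f) Y k p - phi p (K1 X Y k p) + (eps * g p (Y p) (nabla X xi p)) *: xi p
  - (K1 (J1 Y k) X f p - phi p (K1 Y X f p)
     + (eps * g p (X p) (nabla Y xi p)) *: xi p).
Proof.
have sX' := sv_J1 sX sff; have sY' := sv_J1 sY sfk.
rewrite /nij1 -(nabla_torsion p sX sY) -(nabla_torsion p sX' sY').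
rewrite -(nabla_torsion p sX' sY) -(nabla_torsion p sX sY').
rewrite (nabla_J1 p sX' sY sfk) (nabla_J1 p sY' sX sff).
rewrite (nabla_J1 p sX sY sfk) (nabla_J1 p sY sX sff).
rewrite (D_eta p sX sY) (D_eta p sY sX) !phiE !phi2 !phi_xi.
by apply: (g_ext (p := p)) => w; rewrite !gE; ring.
Qed.

Lemma nij2E p : nij2 X f Y k p =
  eps * g p (Y p) (nabla (J1 X f) xi p) - eta p (K1 X Y k p)
  - (eps * g p (X p) (nabla (J1 Y k) xi p) - eta p (K1 Y X f p)).
Proof.
have sX' := sv_J1 sX sff; have sY' := sv_J1 sY sfk.
rewrite /nij2 -(nabla_torsion p sX' sY) -(nabla_torsion p sX sY').
rewrite (nabla_J1 p sX sY sfk) (nabla_J1 p sY sX sff).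
by rewrite (D_eta p sX' sY) (D_eta p sY' sX) !etaE !eta_phi !eta_xi; ring.
Qed.

Hypotheses (S0 : forall X p, sv X -> S X p = 0) (sas : sasakian_eq).

(** When S = 0, the Sasakian equation already gives (D_(J Z) J) W = J (D_Z J) W. *)
Lemma sasakian_nij1 p : nij1 X f Y k p = 0.
Proof.
have sX' := sv_J1 sX sff; have sY' := sv_J1 sY sfk.
rewrite nij1E /K1 !sas // !(KC_nabla_xi S0) // /J1.
rewrite !phiE !phi2 !phi_xi !gE !g_phi !(gC p (xi p)) !g_xi.
rewrite (gC p (X p) (phi p (Y p))) g_phi.
apply: (g_ext (p := p)) => w; rewrite !gE.
by case: eps_sign => ->; ring.
Qed.

Lemma sasakian_nij2 p : nij2 X f Y k p = 0.
Proof.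
have sX' := sv_J1 sX sff; have sY' := sv_J1 sY sfk.
rewrite nij2E /K1 !sas // !(KC_nabla_xi S0) // /J1 !phiE !phi2 !phi_xi.
rewrite !etaE !eta_phi !eta_xi !gE !g_xi (gC p (Y p) (X p)).
by case: eps_sign => ->; ring.
Qed.

End Nijenhuis.

Lemma nij1_normal : (forall X Y p, sv X -> sv Y ->
    nij1 X (fun=> 0) Y (fun=> 0) p = 0) ->
  forall X Y p, sv X -> sv Y ->
  T (fun q => phi q (X q)) Y p - phi p (T X Y p)
  + (eps * g p (Y p) (nabla X xi p)) *: xi p
  = T (fun q => phi q (Y q)) X p - phi p (T Y X p)
  + (eps * g p (X p) (nabla Y xi p)) *: xi p.
Proof.
move=> H X Y p sX sY; apply/eqP; rewrite -subr_eq0.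
have J0 Z : J1 Z (fun=> 0) = fun q => phi q (Z q).
  by apply/funext => q; rewrite /J1 scale0r subr0.
have := H X Y p sX sY; rewrite nij1E // /K1 !J0 !scale0r !subr0 => ->.
exact: eqxx.
Qed.

Definition lie_h X p : E :=
  2^-1 *: (br xi (fun q => phi q (X q)) p - phi p (br xi X p)).

Definition lie_h_codazzi := forall X Y p, sv X -> sv Y ->
  nabla X (lie_h Y) p - lie_h (nabla X Y) p
  = nabla Y (lie_h X) p - lie_h (nabla Y X) p.

Lemma lie_hE X : sv X -> lie_h X = h X.
Proof. by move=> sX; apply/funext => p; exact: h_eq. Qed.

Lemma lie_h_codazziE : lie_h_codazzi -> forall X Y p, sv X -> sv Y ->
  nabla X (h Y) p - h (nabla X Y) p = nabla Y (h X) p - h (nabla Y X) p.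
Proof.
move=> cod X Y p sX sY; have := cod X Y p sX sY.
have sXY := sv_nabla sX sY; have sYX := sv_nabla sY sX.
by rewrite (lie_hE sX) (lie_hE sY) (lie_hE sXY) (lie_hE sYX).
Qed.

Lemma codazzi_sqr0 : lie_h_codazzi -> forall X p, sv X -> lie_h (lie_h X) p = 0.
Proof.
move=> /lie_h_codazziE cod X p sX; rewrite (lie_hE sX) (lie_hE (sv_h sX)).
by rewrite (h_h p sX); have [] := codazzi_xi cod p sX.
Qed.

Lemma sasakian_codazzi_curv :
  (forall X Y p, sv X -> sv Y -> nij1 X (fun=> 0) Y (fun=> 0) p = 0) ->
  lie_h_codazzi /\ forall X Y p, sv X -> sv Y ->
    curv X Y xi p = eta p (Y p) *: X p - eta p (X p) *: Y p.
Proof.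
move=> /nij1_normal nor; have S0 := normal_S0 nor; split; last first.
  exact: sasakian_curv S0 (normal_sasakian nor).
have h0 X : sv X -> lie_h X = fun=> 0.
  by move=> sX; rewrite lie_hE //; apply/funext => p; rewrite /h S0 // phi0.
move=> X Y p sX sY; have sXY := sv_nabla sX sY; have sYX := sv_nabla sY sX.
by rewrite (h0 X sX) (h0 Y sY) (h0 _ sXY) (h0 _ sYX) !nabla0.
Qed.

Lemma codazzi_curv_sasakian : lie_h_codazzi ->
  (forall X Y p, sv X -> sv Y ->
     curv X Y xi p = eta p (Y p) *: X p - eta p (X p) *: Y p) ->
  forall X Y f k p, sv X -> sv Y -> sf f -> sf k ->
    nij1 X f Y k p = 0 /\ nij2 X f Y k p = 0.
Proof.
move=> /lie_h_codazziE cod HR X Y f k p sX sY sff sfk.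
have S0 := K_contact (codazzi_xi cod) HR; have sas := curv_sasakian S0 HR.
by split; [exact: sasakian_nij1 | exact: sasakian_nij2].
Qed.

(** The algebraic content of the theorem, the integrability of J being expressed by
    the components of its Nijenhuis torsion on M. Fields without d/dt component
    suffice to obtain the Sasakian equation. *)
Theorem contact_calculus :
  [/\ lie_h_codazzi -> forall X p, sv X -> lie_h (lie_h X) p = 0,
      (forall X Y p, sv X -> sv Y -> nij1 X (fun=> 0) Y (fun=> 0) p = 0) ->
      lie_h_codazzi /\ forall X Y p, sv X -> sv Y ->
        curv X Y xi p = eta p (Y p) *: X p - eta p (X p) *: Y p &
      lie_h_codazzi ->
      (forall X Y p, sv X -> sv Y ->
        curv X Y xi p = eta p (Y p) *: X p - eta p (X p) *: Y p) ->
      forall X Y f k p, sv X -> sv Y -> sf f -> sf k ->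
        nij1 X f Y k p = 0 /\ nij2 X f Y k p = 0].
Proof.
split; [exact: codazzi_sqr0 | exact: sasakian_codazzi_curv |].
exact: codazzi_curv_sasakian.
Qed.

End ContactCalculus.

(** * Smooth maps on a product *)

Section PairCalculus.
Context {R : realType}.
Implicit Types V W X : normedModType R.

Lemma smooth_on_pair V W X (U : set V) (f : V -> W) (g : V -> X) : open U ->
  smooth_on U f -> smooth_on U g -> smooth_on U (fun x => (f x, g x)).
Proof.
move=> oU sf sg.
pose P (h : V -> (W * X)%type) := exists f g, [/\ smooth_on U f, smooth_on U g &
  h = fun x => (f x, g x)].
apply: (@smooth_on_coind _ _ _ _ P) => //; last by exists f, g.
move=> _ [{sf}f [{sg}g [sf sg ->]]]; split=> [x Ux|v].
  apply: differentiable_pair; first exact: smooth_on_diff sf Ux.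
  exact: smooth_on_diff sg Ux.
exists (fun x => ('D_v f x, 'D_v g x)).
  by exists ('D_v f), ('D_v g); split=> //; exact: smooth_on_derive.
move=> x Ux; apply: derive_pair; first exact: smooth_on_diff sf Ux.
exact: smooth_on_diff sg Ux.
Qed.

Lemma fst_linear V W : linear (fst : V * W -> V). Proof. by []. Qed.
Lemma snd_linear V W : linear (snd : V * W -> W). Proof. by []. Qed.
Lemma fst_continuous V W : continuous (fst : V * W -> V).
Proof. by move=> x; exact: cvg_fst. Qed.
Lemma snd_continuous V W : continuous (snd : V * W -> W).
Proof. by move=> x; exact: cvg_snd. Qed.

Lemma derive_clin_id V W (l : V -> W) x v : linear l -> continuous l ->
  differentiable l x /\ 'D_v l x = l v.
Proof.
move=> ll lc; have did : differentiable (@id V) x by exact: ex_diff.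
by have [dl lE] := derive_clin v ll lc did; split=> //; rewrite lE derive_id.
Qed.

Lemma pair_scale V W (a : R) (v : V) (w : W) : (a *: v, a *: w) = a *: (v, w).
Proof. by []. Qed.
Lemma pair_add V W (v v' : V) (w w' : W) : (v + v', w + w') = (v, w) + (v', w').
Proof. by []. Qed.

Lemma slice_derive V W X (F : V * W -> X) (t : W) y v :
  'D_v (fun z => F (z, t)) y = 'D_(v, 0) F (y, t).
Proof.
rewrite /derive
  (_ : (fun h : R => h^-1 *: (((fun z => F (z, t)) \o shift y) (h *: v) - F (y, t)))
  = (fun h : R => h^-1 *: ((F \o shift (y, t)) (h *: (v, 0)) - F (y, t)))) //.
apply/funext => h /=; congr (_ *: (F _ - _)).
by rewrite -pair_scale /= -pair_add scaler0 add0r.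
Qed.

Lemma slice_differentiable V W X (F : V * W -> X) (t : W) y :
  differentiable F (y, t) -> differentiable (fun z => F (z, t)) y.
Proof.
move=> dF; have d : differentiable (fun z : V => (z, t)) y;
  last exact: (differentiable_comp d dF).
by apply: differentiable_pair; [exact: ex_diff | exact: differentiable_cst].
Qed.

(** The derivatives of a slice are the slices of the derivatives in the directions
    (v, 0). *)
Lemma smooth_on_slice V W X (U : set V) (U' : set (V * W)) (F : V * W -> X) t :
  (forall y, U y -> U' (y, t)) -> smooth_on U' F -> smooth_on U (fun y => F (y, t)).
Proof.
move=> UU sF vs y Uy.
have -> : foldr (fun v (g : V -> X) => 'D_v g) (fun y => F (y, t)) vs =
    fun y => foldr (fun v (g : V * W -> X) => 'D_v g) F [seq (v, 0) | v <- vs] (y, t).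
  elim: vs => [//|v vs IH] /=; rewrite IH; apply/funext => z; exact: slice_derive.
by apply: slice_differentiable; apply: sF; exact: UU.
Qed.

Lemma slice_derive_snd V W X (F : V * W -> X) (t : W) y v :
  'D_v (fun s => F (y, s)) t = 'D_(0, v) F (y, t).
Proof.
rewrite /derive
  (_ : (fun h : R => h^-1 *: (((fun s => F (y, s)) \o shift t) (h *: v) - F (y, t)))
  = (fun h : R => h^-1 *: ((F \o shift (y, t)) (h *: (0, v)) - F (y, t)))) //.
apply/funext => h /=; congr (_ *: (F _ - _)).
by rewrite -pair_scale /= -pair_add scaler0 add0r.
Qed.

Lemma linear_row_smooth m W (l : 'rV[R]_m.+1 -> W) : linear l -> smooth_on setT l.
Proof.
move=> ll; have oT := @openT 'rV[R]_m.+1.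
pose lM := GRing.isLinear.Build _ _ _ _ _ ll.
pose lL : {linear _ -> _} := HB.pack l lM.
have [cl cc _] := @row_frame R m.
apply: (smooth_on_eq (g := fun v : 'rV[R]_m.+1 =>
    \sum_i (v 0 i : R^o) *: l (delta_mx 0 i))) => //.
  move=> v _; rewrite {2}[v]row_sum_delta -[l (\sum_i _)]/(lL _) linear_sum.
  by apply: eq_bigr => i _; rewrite linearZ.
apply: smooth_on_sum => // i; apply: smooth_on_scale => //; last exact: smooth_on_cst.
exact: (smooth_on_clin oT (cl i) (cc i) (smooth_on_id oT)).
Qed.

End PairCalculus.

(** * Vector fields on M x R *)

Section ProductManifold.
Context {R : realType} {m : nat} {M : topologicalType}.
Local Notation E := ('rV[R]_m.+1).
Variable A : M -> chart M E.
Hypothesis mfd : smooth_manifold A.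
Local Notation dom p := (chart_dom (A p)).
Local Notation img p := (chart_img (A p)).
Local Notation cm p := (chart_map (A p)).
Local Notation ci p := (chart_inv (A p)).
Local Notation MR := ((M * R^o)%type).
Local Notation ER := ((E * R^o)%type).

(** The fields on M and the functions on M in which a vector field on M x R
    decomposes at time t. *)
Definition vpart (Z : MR -> ER) (t : R^o) (p : M) : E := (Z (p, t)).1.
Definition fpart (Z : MR -> ER) (t : R^o) (p : M) : R^o := (Z (p, t)).2.

Lemma img_prod p s : chart_img (prod_atlas A (p, s)) = [set z : ER | img p z.1].
Proof.
apply/seteqP; split=> [_ [[q t] /= pq <-]|[y t] [q pq /= qy]]; first by exists q.
by exists (q, t) => //=; rewrite qy.
Qed.

Lemma img_prod_open p : open [set z : ER | img p z.1].
Proof.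
apply: open_comp; last exact: (img_open mfd).
by move=> z _; exact: cvg_fst.
Qed.

Arguments img_prod_open : clear implicits.

Lemma read_prod p s Z y t : img p y -> read (prod_atlas A) (p, s) Z (y, t)
  = (read A p (vpart Z t) y, fpart Z t (ci p y)).
Proof.
move=> py; set q := ci p y.
rewrite /read /=.
have pq : dom p q by exact: dom_ci.
have dt : differentiable (cm p \o ci q) (cm q q).
  exact: (transition_diff mfd (dom_self mfd q) pq).
have [dfst fstE] := @derive_clin_id _ _ _ _ (cm q q, t) (Z (q, t))
  (@fst_linear R E R^o) (@fst_continuous R E R^o).
have [dsnd sndE] := @derive_clin_id _ _ _ _ (cm q q, t) (Z (q, t))
  (@snd_linear R E R^o) (@snd_continuous R E R^o).
have dct : differentiable ((cm p \o ci q) \o (fst : ER -> E)) (cm q q, t).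
  exact: differentiable_comp.
rewrite (_ : _ \o _ = fun z : ER => (((cm p \o ci q) \o fst) z, snd z)) //.
rewrite (derive_pair _ dct dsnd) (derive_comp _ dfst dt).
by rewrite fstE sndE.
Qed.

(** The components of Z in the charts of M x R over the chart at p. *)
Definition prod_expr (Z : MR -> ER) p (z : ER) : ER :=
  (read A p (vpart Z z.2) z.1, fpart Z z.2 (ci p z.1)).

Lemma smooth_vf_prodP Z : smooth_vf (prod_atlas A) Z <->
  forall p, smooth_on [set z : ER | img p z.1] (prod_expr Z p).
Proof.
split=> sZ p.
  have := sZ (p, 0); rewrite img_prod; apply: smooth_on_eq; first exact: img_prod_open.
  by move=> [y t] /= py; rewrite read_prod.
case: p => p s; rewrite img_prod.
apply: smooth_on_eq (sZ p); first exact: img_prod_open.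
by move=> [y t] /= py; rewrite read_prod.
Qed.

Lemma prod_expr_fst Z p : smooth_vf (prod_atlas A) Z ->
  smooth_on [set z : ER | img p z.1] (fun z => read A p (vpart Z z.2) z.1).
Proof.
move=> /smooth_vf_prodP/(_ p) sZ.
have := smooth_on_clin (img_prod_open p) (@fst_linear R E R^o)
  (@fst_continuous R E R^o) sZ.
exact.
Qed.

Lemma prod_expr_snd Z p : smooth_vf (prod_atlas A) Z ->
  smooth_on [set z : ER | img p z.1] (fun z => fpart Z z.2 (ci p z.1)).
Proof.
move=> /smooth_vf_prodP/(_ p) sZ.
exact: (smooth_on_clin (img_prod_open p) (@snd_linear R E R^o)
  (@snd_continuous R E R^o) sZ).
Qed.

Lemma vpart_smooth Z t : smooth_vf (prod_atlas A) Z -> smooth_vf A (vpart Z t).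
Proof.
move=> sZ p; have := prod_expr_fst (p := p) sZ.
by apply: (smooth_on_slice (t := t)).
Qed.

Lemma fpart_smooth Z t : smooth_vf (prod_atlas A) Z -> smooth_fun A (fpart Z t).
Proof.
move=> sZ p; have := prod_expr_snd (p := p) sZ.
by apply: (smooth_on_slice (t := t)).
Qed.

Lemma fst_smooth (U : set ER) : smooth_on U (fst : ER -> E).
Proof.
apply: (smooth_on_sub (U' := setT)) => //.
exact: (smooth_on_clin openT (@fst_linear R E R^o) (@fst_continuous R E R^o)
  (smooth_on_id openT)).
Qed.

Lemma lift_smooth X : smooth_vf A X ->
  smooth_vf (prod_atlas A) (fun x : MR => (X x.1, 0) : ER).
Proof.
move=> sX; apply/smooth_vf_prodP => p; have oP := img_prod_open p.
have sF : smooth_on [set z : ER | img p z.1] (fst : ER -> E) by exact: fst_smooth.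
apply: (smooth_on_pair oP _ (@smooth_on_cst R ER R^o _ 0 oP)).
exact: (smooth_on_comp (@row_frame R m) oP (fun z Hz => Hz) sF (sX p)).
Qed.

(** At fixed p a vector field on M x R is a curve in the vector space T_p M x R, and
    dt is its ordinary derivative. *)
Definition dt (Z : MR -> ER) (x : MR) : ER := 'D_1 (fun s : R^o => Z (x.1, s)) x.2.

Lemma prod_expr_self Z p t : prod_expr Z p (cm p p, t) = Z (p, t).
Proof.
have pp := dom_self mfd p.
by rewrite /prod_expr /= read_self // ciK // /vpart /fpart; case: (Z (p, t)).
Qed.

Lemma prod_expr_diff Z p t : smooth_vf (prod_atlas A) Z ->
  differentiable (prod_expr Z p) (cm p p, t).
Proof.
move=> /smooth_vf_prodP/(_ p) sZ; apply: smooth_on_diff sZ _ => /=.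
exact/img_cm/dom_self.
Qed.

(** The differential in the direction (u, a) is the sum of the differential in the
    direction u at fixed time and of a times the time derivative. *)
Lemma derive_prod_expr Z p t u a : smooth_vf (prod_atlas A) Z ->
  'D_(u, a) (prod_expr Z p) (cm p p, t) =
  ('D_u (read A p (vpart Z t)) (cm p p), 'D_u (fpart Z t \o ci p) (cm p p))
  + a *: dt Z (p, t).
Proof.
move=> sZ; have dZ := prod_expr_diff p t sZ; have pp := dom_self mfd p.
have -> : (u, a) = a *: ((0, 1) : ER) + (u, 0).
  by rewrite -pair_scale -pair_add scaler0 add0r addr0 [a *: _]mulr1.
rewrite (derive_linear _ _ _ dZ) addrC -slice_derive -slice_derive_snd.
have -> : 'D_1 (fun s => prod_expr Z p (cm p p, s)) t = dt Z (p, t).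
  by rewrite /dt /=; congr ('D_1 _ t); apply/funext => s; exact: prod_expr_self.
congr (_ + _); apply: derive_pair.
  by apply: smooth_on_diff (@vpart_smooth Z t sZ p) _; exact: img_cm.
exact: smooth_fun_diff (@fpart_smooth Z t sZ) pp.
Qed.

Let addr_sub_acc (x y dx dy : ER) : x + dx - (y + dy) = x - y + (dx - dy).
Proof. by rewrite opprD addrACA. Qed.

(** Each field is differentiated along the other one at fixed time, plus its time
    derivative multiplied by the d/dt component of the other one. *)
Lemma bracket_prod Z W p t : smooth_vf (prod_atlas A) Z ->
  smooth_vf (prod_atlas A) W -> bracket (prod_atlas A) Z W (p, t) =
  (bracket A (vpart Z t) (vpart W t) p,
   act A (vpart Z t) (fpart W t) p - act A (vpart W t) (fpart Z t) p)
  + (fpart Z t p *: dt W (p, t) - fpart W t p *: dt Z (p, t)).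
Proof.
move=> sZ sW.
have HD (V1 V2 : MR -> ER) : smooth_vf (prod_atlas A) V2 ->
    'D_(V1 (p, t)) (read (prod_atlas A) (p, t) V2) (cm p p, t) =
    ('D_(vpart V1 t p) (read A p (vpart V2 t)) (cm p p), act A (vpart V1 t) (fpart V2 t) p)
    + fpart V1 t p *: dt V2 (p, t).
  move=> sV2; rewrite -(derive_prod_expr p t (vpart V1 t p) (fpart V1 t p) sV2).
  have -> : V1 (p, t) = (vpart V1 t p, fpart V1 t p).
    by rewrite /vpart /fpart; case: (V1 (p, t)).
  apply: near_eq_derive.
  have px : [set z : ER | img p z.1] (cm p p, t) by exact/img_cm/dom_self.
  have n0 : nbhs ((cm p p, t) : ER) [set z : ER | img p z.1].
    exact: (open_nbhs_nbhs (conj (img_prod_open p) px)).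
  by apply: filterS n0 => -[y s] /= py; rewrite read_prod.
have E1 := HD Z W sW; have E2 := HD W Z sZ.
exact: (etrans (congr2 (fun x y : ER => x - y) E1 E2) (addr_sub_acc _ _ _ _)).
Qed.

(** Near a point, a family of vector fields is a combination of the fields of a
    local frame of M, with coefficients that depend on t; a fibrewise linear
    operation carries this over to its values on the frame. *)
Lemma smooth_on_family {W : normedModType R} p (Lp : M -> E -> W)
    (Y : R^o -> M -> E) :
  (forall y, img p y -> linear (Lp (ci p y))) ->
  (forall X, smooth_vf A X ->
     smooth_on (img p) (fun y => Lp (ci p y) (X (ci p y)))) ->
  smooth_on [set z : ER | img p z.1] (fun z => read A p (Y z.2) z.1) ->
  smooth_on [set z : ER | img p z.1] (fun z => Lp (ci p z.1) (Y z.2 (ci p z.1))).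
Proof.
move=> lL sL sY; apply: smooth_on_near => -[y0 t0] /= py0.
have [U [c [Es [[oU Uy0 Up] [sc sEs HE]]]]] := local_frame mfd py0.
have oU' : open [set z : ER | U z.1].
  by apply: open_comp oU => z _; exact: cvg_fst.
have sfst : smooth_on [set z : ER | U z.1] (fst : ER -> E) by exact: fst_smooth.
pose G (z : ER) : W := \sum_i
  ((read A p (Y z.2) z.1 0 i : R^o) * c z.1 : R^o) *: Lp (ci p z.1) (Es i (ci p z.1)).
exists [set z : ER | U z.1], G; split=> //.
  have [cl cc _] := @row_frame R m.
  have sY' : smooth_on [set z : ER | U z.1] (fun z => read A p (Y z.2) z.1).
    by apply: smooth_on_sub sY => z /Up.
  apply: smooth_on_sum => // i; apply: smooth_on_scale => //.
    apply: smooth_on_scale => //; first exact: (smooth_on_clin oU' (cl i) (cc i) sY').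
    by apply: (smooth_on_comp (@row_frame R m) oU' _ sfst sc).
  apply: (smooth_on_comp (@row_frame R m) oU' _ sfst (sL _ (sEs i))).
  by move=> z /Up.
have n0 : nbhs ((y0, t0) : ER) [set z : ER | U z.1].
  have Uz0 : [set z : ER | U z.1] (y0, t0) by exact: Uy0.
  exact: (open_nbhs_nbhs (conj oU' Uz0)).
apply: filterS n0 => -[y t] /= Uy.
by rewrite (HE (Y t) y Uy) (linear_sumZ _ _ (lL _ (Up _ Uy))).
Qed.

End ProductManifold.

(** * The almost complex structure of M x R *)

Section AlmostComplex.
Context {R : realType} {n : nat} {M : topologicalType}.
Local Notation m := (n.*2).
Local Notation E := ('rV[R]_m.+1).
Variable A : M -> chart M E.
Hypothesis mfd : smooth_manifold A.
Local Notation img p := (chart_img (A p)).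
Local Notation cm p := (chart_map (A p)).
Local Notation ci p := (chart_inv (A p)).
Local Notation MR := ((M * R^o)%type).
Local Notation ER := ((E * R^o)%type).
Variables (phi : M -> E -> E) (xi : M -> E) (eta : M -> E -> R^o).
Hypotheses (tphi : tensor11 A phi) (sxi : smooth_vf A xi) (oeta : one_form A eta).
Local Notation J := (on_vf (J_tensor phi xi eta)).

Lemma vpart_J Z t p : vpart (J Z) t p = phi p (vpart Z t p) - fpart Z t p *: xi p.
Proof. by []. Qed.

Lemma J_smooth Z : smooth_vf (prod_atlas A) Z -> smooth_vf (prod_atlas A) (J Z).
Proof.
move=> sZ; apply/(smooth_vf_prodP mfd) => p; have oP := @img_prod_open _ _ _ _ mfd p.
have [lphi sphi] := tphi; have [leta seta] := oeta.
have srZ := prod_expr_fst mfd (p := p) sZ; have sfZ := prod_expr_snd mfd (p := p) sZ.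
have G2 : smooth_on [set z : ER | img p z.1] (fun z => fpart (J Z) z.2 (ci p z.1)).
  have sE X : smooth_vf A X ->
      smooth_on (img p) (fun y => eta (ci p y) (X (ci p y))).
    by move=> sX; exact: (seta X sX p).
  exact: (smooth_on_family mfd (fun y _ => leta (ci p y)) sE srZ).
have G1 : smooth_on [set z : ER | img p z.1] (fun z => read A p (vpart (J Z) z.2) z.1).
  have sfst : smooth_on [set z : ER | img p z.1] (fst : ER -> E).
    exact: fst_smooth.
  have s1 : smooth_on [set z : ER | img p z.1] (fun z => read A p xi z.1).
    exact: (smooth_on_comp (@row_frame R m) oP (fun z Hz => Hz) sfst (sxi (p := p))).
  have sP X : smooth_vf A X -> smooth_on (img p) (fun y =>
      transport A (ci p y) p (ci p y) (phi (ci p y) (X (ci p y)))).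
    by move=> sX; exact: (sphi X sX p).
  have lP y : img p y ->
      linear (fun u => transport A (ci p y) p (ci p y) (phi (ci p y) u)).
    move=> py a u v; rewrite lphi.
    by rewrite (transport_linear mfd (dom_self mfd _) (dom_ci mfd py)).
  have s2 := smooth_on_family mfd (Lp := fun q u => transport A q p q (phi q u))
    lP sP srZ.
  have s3 := smooth_on_scale oP (@smooth_on_cst R ER R^o _ (-1) oP) sfZ.
  apply: (smooth_on_eq oP _ (smooth_on_add oP (smooth_on_scale oP s3 s1) s2)).
  move=> [y t] py.
  have := read_lin mfd (fun q => (-1 : R^o) *: fpart Z t q) xi
    (fun q => phi q (vpart Z t q)) py.
  move=> H; apply: (etrans (esym H)); apply: read_local.
  by rewrite vpart_J addrC; congr (_ + _); rewrite -scalerA scaleN1r.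
exact: (smooth_on_pair oP G1 G2).
Qed.

Lemma J_linear x : linear (J_tensor phi xi eta x).
Proof.
have [lphi _] := tphi; have [leta _] := oeta.
move=> a [u b] [v c]; rewrite /J_tensor /= lphi leta.
rewrite -pair_scale -pair_add; congr (_, _).
by rewrite scalerDl scalerBr opprD addrACA scalerA.
Qed.

Lemma J_continuous x : continuous (J_tensor phi xi eta x).
Proof.
have [lphi _] := tphi; have [leta _] := oeta.
have oT := @openT ER.
have sfst : smooth_on setT (fst : ER -> E) by exact: fst_smooth.
have ssnd : smooth_on setT (snd : ER -> R^o).
  exact: (smooth_on_clin oT (@snd_linear R E R^o)
    (@snd_continuous R E R^o) (smooth_on_id oT)).
have sJ : smooth_on setT (J_tensor phi xi eta x).
  apply: smooth_on_pair => //; last first.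
    by apply: (smooth_on_comp (@row_frame R m) oT _ sfst (linear_row_smooth (leta x.1))).
  rewrite (_ : (fun z : ER => _) = fun z : ER => phi x.1 z.1 +
      ((-1 : R^o) *: z.2 : R^o) *: xi x.1); last first.
    by apply/funext => z; rewrite -[(-1 *: _) *: _]scalerA scaleN1r.
  apply: smooth_on_add => //.
    by apply: (smooth_on_comp (@row_frame R m) oT _ sfst (linear_row_smooth (lphi x.1))).
  apply: smooth_on_scale => //; last exact: smooth_on_cst.
  by apply: smooth_on_scale => //; exact: smooth_on_cst.
by move=> z; exact: (differentiable_continuous (smooth_on_diff sJ I)).
Qed.

Lemma curve_diff Z p t : smooth_vf (prod_atlas A) Z ->
  differentiable (fun s : R^o => Z (p, s)) t.
Proof.
move=> sZ; have dZ := prod_expr_diff mfd p t sZ.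
rewrite (_ : (fun s : R^o => Z (p, s)) = fun s => prod_expr A Z p (cm p p, s)); last first.
  by apply/funext => s; rewrite (prod_expr_self mfd).
apply: (differentiable_comp (f := fun s : R^o => (cm p p, s)) _ dZ).
by apply: differentiable_pair; [exact: differentiable_cst | exact: ex_diff].
Qed.

(** Because J is linear in the fibres and does not depend on t. *)
Lemma dt_J Z p t : smooth_vf (prod_atlas A) Z ->
  dt (J Z) (p, t) = J_tensor phi xi eta (p, t) (dt Z (p, t)).
Proof.
move=> sZ; have [_ <-] := derive_clin (1 : R^o) (@J_linear (p, t)) (@J_continuous (p, t))
  (curve_diff p t sZ).
by [].
Qed.

End AlmostComplex.

Section NijenhuisProduct.
Context {R : realType} {n : nat} {M : topologicalType}.
Local Notation m := (n.*2).
Local Notation E := ('rV[R]_m.+1).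
Local Notation ER := ((E * R^o)%type).
Variable A : M -> chart M E.
Hypothesis mfd : smooth_manifold A.
Variables (phi : M -> E -> E) (xi : M -> E) (eta : M -> E -> R^o).
Hypotheses (tphi : tensor11 A phi) (sxi : smooth_vf A xi) (oeta : one_form A eta).
Hypothesis phi2 : forall p u, phi p (phi p u) = - u + eta p u *: xi p.
Hypothesis eta_xi : forall p, eta p (xi p) = 1.
Hypothesis phi_xi : forall p, phi p (xi p) = 0.
Hypothesis eta_phi : forall p u, eta p (phi p u) = 0.
Local Notation J := (on_vf (J_tensor phi xi eta)).

Lemma J_tensor2 x z : J_tensor phi xi eta x (J_tensor phi xi eta x z) = - z.
Proof.
have [lphi _] := tphi; have [leta _] := oeta.
case: z => u a; rewrite /J_tensor /=.
have phiB v b : phi x.1 (v - b *: xi x.1) = phi x.1 v.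
  by rewrite addrC -scaleNr lphi phi_xi scaler0 add0r.
have etaB v b : eta x.1 (v - b *: xi x.1) = eta x.1 v - b.
  by rewrite addrC -scaleNr leta eta_xi addrC; congr (_ + _); exact: mulr1.
by rewrite phiB etaB phi2 addrK eta_phi sub0r.
Qed.

Let zmod_cancel (x1 x2 x3 x4 a b c d : ER) :
  x1 + (a - b) + (x2 + (c - d)) - (x3 + (c - b)) - (x4 + (a - d))
  = x1 + x2 - x3 - x4.
Proof.
case: x1 x2 x3 x4 a b c d => [u1 v1] [u2 v2] [u3 v3] [u4 v4] [a a'] [b b'] [c c'] [d d'].
congr (_, _); last by rewrite /=; ring.
by apply/rowP => i; rewrite /= !mxE; ring.
Qed.

Let nijenhuis_cancel (j : ER -> ER) (x1 x2 x3 x4 w z : ER) (e e' f k : R) :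
  linear j ->
  j (j (x1 + (f *: w - k *: z))) + (x2 + (e *: j w - e' *: j z))
  - j (x3 + (e *: w - k *: j z)) - j (x4 + (f *: j w - e' *: z))
  = j (j x1) + x2 - j x3 - j x4.
Proof.
move=> lj.
have jE x u v (a b : R) : j (x + (a *: u - b *: v)) = j x + (a *: j u - b *: j v).
  have -> : x + (a *: u - b *: v) = a *: u + (- b *: v + x).
    by rewrite scaleNr addrC -addrA.
  by rewrite lj lj scaleNr addrA addrC.
rewrite jE jE jE jE; exact: zmod_cancel.
Qed.

(** As J is fibrewise linear, independent of t and of square - 1, all time
    derivatives cancel, and only the brackets on M and the derivatives along fields
    of M remain. *)
Lemma nijenhuis_prod Z W p t : smooth_vf (prod_atlas A) Z ->
  smooth_vf (prod_atlas A) W -> nijenhuis (prod_atlas A) J Z W (p, t) =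
  (nij1 (act A) (bracket A) phi xi eta (vpart Z t) (fpart Z t) (vpart W t) (fpart W t) p,
   nij2 (act A) (bracket A) phi xi eta (vpart Z t) (fpart Z t) (vpart W t) (fpart W t) p).
Proof.
move=> sZ sW; have sJZ := J_smooth mfd tphi sxi oeta sZ.
have sJW := J_smooth mfd tphi sxi oeta sW.
pose j := J_tensor phi xi eta (p, t).
have -> : nijenhuis (prod_atlas A) J Z W (p, t) =
  j (j (bracket (prod_atlas A) Z W (p, t)))
  + bracket (prod_atlas A) (J Z) (J W) (p, t)
  - j (bracket (prod_atlas A) (J Z) W (p, t))
  - j (bracket (prod_atlas A) Z (J W) (p, t)) by [].
rewrite (bracket_prod mfd p t sZ sW) (bracket_prod mfd p t sJZ sJW).
rewrite (bracket_prod mfd p t sJZ sW) (bracket_prod mfd p t sZ sJW).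
rewrite (dt_J mfd xi tphi oeta p t sZ) (dt_J mfd xi tphi oeta p t sW).
rewrite (nijenhuis_cancel _ _ _ _ _ _ _ _ _ _ (J_linear xi tphi oeta _)).
by rewrite J_tensor2.
Qed.

End NijenhuisProduct.

(** * Codazzi condition and Sasakian structures *)

Theorem theorem3p1 (R : realType) (n : nat) (M : topologicalType)
  (A : M -> chart M 'rV[R]_(n.*2.+1))
  (phi : M -> 'rV[R]_(n.*2.+1) -> 'rV[R]_(n.*2.+1))
  (xi : M -> 'rV[R]_(n.*2.+1))
  (eta : M -> 'rV[R]_(n.*2.+1) -> R^o)
  (g : M -> 'rV[R]_(n.*2.+1) -> 'rV[R]_(n.*2.+1) -> R^o)
  (eps : R)
  (nabla : (M -> 'rV[R]_(n.*2.+1)) -> (M -> 'rV[R]_(n.*2.+1)) ->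
           (M -> 'rV[R]_(n.*2.+1)))
  (contact : contact_pseudo_metric A phi xi eta g eps)
  (LC : levi_civita A g nabla) :
  let h := h_tensor A phi xi in
  (codazzi A nabla h ->
     forall X, smooth_vf A X -> h (h X) = (fun=> 0)) /\
  (sasakian_pseudo_metric A phi xi eta g eps <->
     (forall X Y, smooth_vf A X -> smooth_vf A Y ->
        curvature A nabla X Y xi
        = (fun p => eta p (Y p) *: X p - eta p (X p) *: Y p)) /\
     codazzi A nabla h).
Proof.
move=> h; have [acm dcontact] := contact.
have [mfd tphi sxi oeta [gC glin gnd sg] eps1 phi2 eta_xi phi_xi eta_phi compat] := acm.
have [sN nabla_l nabla_r torsion metric] := LC.
have [lphi sphi] := tphi; have [leta seta] := oeta.
have brE X Y : smooth_vf A X -> smooth_vf A Y -> forall p,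
    nabla X Y p - nabla Y X p = bracket A X Y p.
  by move=> sX sY p; rewrite -(torsion X Y sX sY).
have sbr X Y : smooth_vf A X -> smooth_vf A Y -> smooth_vf A (bracket A X Y).
  move=> sX sY.
  have := smooth_vf_lin mfd (smooth_fun_cst mfd (-1)) (sN Y X sY sX) (sN X Y sX sY).
  congr (smooth_vf A _); apply/funext => p.
  by rewrite -(brE X Y sX sY) scaleN1r addrC.
have gP p (a : R) u v w : g p (a *: u + v) w = a * g p u w + g p v w.
  by rewrite (gC p (a *: u + v) w) (gC p u w) (gC p v w); exact: glin.
have nabla_tensor X X' Y f p : smooth_vf A X -> smooth_vf A X' -> smooth_vf A Y ->
    smooth_fun A f ->
    nabla (fun q => f q *: X q + X' q) Y p = f p *: nabla X Y p + nabla X' Y p.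
  by move=> sX sX' sY sf; rewrite (nabla_l X X' Y f sX sX' sY sf).
have nabla_leibniz X Y Y' f p : smooth_vf A X -> smooth_vf A Y -> smooth_vf A Y' ->
    smooth_fun A f -> nabla X (fun q => f q *: Y q + Y' q) p
    = act A X f p *: Y p + f p *: nabla X Y p + nabla X Y' p.
  by move=> sX sY sY' sf; rewrite (nabla_r X Y Y' f sX sY sY' sf).
have nabla_metric X Y Z p : smooth_vf A X -> smooth_vf A Y -> smooth_vf A Z ->
    act A X (fun q => g q (Y q) (Z q)) p
    = g p (nabla X Y p) (Z p) + g p (Y p) (nabla X Z p).
  by move=> sX sY sZ; rewrite (metric X Y Z sX sY sZ).
have dcontact2 X Y p : smooth_vf A X -> smooth_vf A Y ->
    act A X (fun q => eta q (Y q)) p - act A Y (fun q => eta q (X q)) p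
    - eta p (bracket A X Y p) = 2 * g p (X p) (phi p (Y p)).
  move=> sX sY; have /(congr1 (@^~ p)) := dcontact X Y sX sY.
  by rewrite /d1 => <-; rewrite mulVKf // pnatr_eq0.
have [sqr0 sas_to to_sas] := contact_calculus
  (smooth_fun_cst mfd) (@smooth_fun_add _ _ _ _ mfd) (@smooth_fun_mul _ _ _ _ mfd)
  (@smooth_fun_act _ _ _ _ mfd) (@smooth_vf_lin _ _ _ _ mfd) (smooth_vf0 mfd)
  (@act_add _ _ _ _ mfd) (@act_mul _ _ _ _ mfd) (@act_cst _ _ _ A)
  (fun X Y f p sX sY sf => act_bracket mfd sX sY sf p)
  (fun X Y Z p sX sY sZ => bracket_jacobi mfd sbr sX sY sZ p)
  gC gP gnd (exists_smooth_vf mfd) sg sN nabla_tensor nabla_leibniz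
  (fun X Y p sX sY => brE X Y sX sY p) nabla_metric lphi sphi sxi leta seta eps1
  phi2 eta_xi phi_xi eta_phi compat dcontact2.
have codP : codazzi A nabla h <->
    lie_h_codazzi (smooth_vf A) (bracket A) nabla phi xi.
  split=> cod X Y => [p|] sX sY; first exact: (congr1 (@^~ p) (cod X Y sX sY)).
  by apply/funext => p; exact: (cod X Y p sX sY).
split; first by move=> /codP cod X sX; apply/funext => p; exact: sqr0.
split=> [[_ intJ]|[HR /codP cod]].
  have N0 X Y p : smooth_vf A X -> smooth_vf A Y ->
      nij1 (act A) (bracket A) phi xi eta X (fun=> 0) Y (fun=> 0) p = 0.
    move=> sX sY; have lX := lift_smooth mfd sX; have lY := lift_smooth mfd sY.
    have := congr1 (@^~ (p, 0)) (intJ _ _ lX lY).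
    by rewrite (nijenhuis_prod mfd tphi sxi oeta phi2 eta_xi phi_xi eta_phi p 0 lX lY)
      => -[].
  have [cod HR] := sas_to N0; split; last exact/codP.
  by move=> X Y sX sY; apply/funext => p; exact: (HR X Y p sX sY).
split=> // Z W sZ sW; apply/funext => -[p t].
rewrite (nijenhuis_prod mfd tphi sxi oeta phi2 eta_xi phi_xi eta_phi p t sZ sW).
have HR' X Y p' : smooth_vf A X -> smooth_vf A Y ->
    nabla X (nabla Y xi) p' - nabla Y (nabla X xi) p' - nabla (bracket A X Y) xi p'
    = eta p' (Y p') *: X p' - eta p' (X p') *: Y p'.
  by move=> sX sY; exact: (congr1 (@^~ p') (HR X Y sX sY)).
have [-> ->] := to_sas cod HR' _ _ _ _ p (vpart_smooth mfd t sZ)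
  (vpart_smooth mfd t sW) (fpart_smooth mfd t sZ) (fpart_smooth mfd t sW).
by [].
Qed.
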